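(* Let $M$ be a smooth Riemannian manifold, let $f\colon M\to M$ be a $C^2$-diffeomorphism, and let $\Lambda\subset M$ be a compact locally maximal $f$-invariant set with $h_{\rm top}(f|\Lambda)>0$ containing a point with a positive Lyapunov exponent. Let $U\subset M$ be an open neighborhood of $\Lambda$ with $\Lambda=\bigcap_{n\in\mathbb{Z}}f^n(U)$, and let $V\subset U$ be an open neighborhood of $\Lambda$. Then $$\overline{\dim}_{\rm B}\Lambda\le\dim M+\frac{\overline{E}(V)}{s}.$$ In particular, if $\overline{E}(V)<0$ then $\overline{\dim}_{\rm B}\Lambda<\dim M$.
   Context: Locally maximal means that an open neighborhood $U$ of $\Lambda$ with $\Lambda=\bigcap_{n\in\mathbb{Z}}f^n(U)$ exists. $h_{\rm top}(f|\Lambda)$ is the topological entropy. $\overline{\dim}_{\rm B}$ denotes the upper box dimension. ''A point with a positive Lyapunov exponent'' means a point $x\in\Lambda$ for which there is $v\in T_xM\setminus\{0\}$ with $\lambda^+(x,v)=\limsup_{n\to\infty}\frac1n\log\|Df^n(x)(v)\|>0$. The upper (exponential) escape rate from $V$ is $$\overline{E}(V)=\limsup_{n\to\infty}\frac1n\log\left(\mathrm{vol}\bigcap_{k=0}^{n-1}f^{-k}(V)\right),$$ where $\mathrm{vol}$ is the volume induced by the Riemannian metric on $M$, and $$s=\lim_{n\to\infty}\frac1n\log\left(\max_{x\in\Lambda}\|Df^n(x)\|\right),$$ where the limit exists by subadditivity. *)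

(* Defs.v *)
From HB Require Import structures.
From mathcomp Require Import all_boot all_order all_algebra.
From mathcomp Require Import all_classical all_reals all_analysis.

Set Implicit Arguments.
Unset Strict Implicit.
Unset Printing Implicit Defensive.

Import Order.TTheory GRing.Theory Num.Theory.
Import numFieldNormedType.Exports.

Local Open Scope classical_set_scope.
Local Open Scope ring_scope.

(* [f] is of class C^k on the open set [O]. For finite-dimensional [V], C^k
   regularity of all directional derivatives is that of the partial ones. *)
Fixpoint Ck_on (R : realType) (V W : normedModType R) (k : nat) (O : set V)
    (f : V -> W) : Prop :=
  match k with
  | 0 => forall x, O x -> {for x, continuous f}
  | k'.+1 => (forall x, O x -> differentiable f x) /\
             forall v, Ck_on k' O (fun x => 'D_v f x)
  end.

(* [chart_map] and [chart_inv] are total functions, but they are meaningful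
   only on [chart_dom] and [chart_ran] respectively. *)
Record chart (R : realType) (n : nat) (M : topologicalType) := Chart {
  chart_dom : set M ;
  chart_map :> M -> 'rV[R]_n ;
  chart_inv : 'rV[R]_n -> M ;
  chart_dom_open : open chart_dom ;
  chart_ran_open : open (chart_map @` chart_dom) ;
  chart_mapK : forall x, chart_dom x -> chart_inv (chart_map x) = x ;
  chart_map_continuous :
    forall x, chart_dom x -> {for x, continuous chart_map} ;
  chart_inv_continuous :
    forall y, (chart_map @` chart_dom) y -> {for y, continuous chart_inv}
}.

Definition chart_ran (R : realType) (n : nat) (M : topologicalType)
  (phi : chart R n M) : set 'rV[R]_n := phi @` chart_dom phi.

(* A smooth atlas, not required to be maximal; [M] may be disconnected. *)
Record smooth_manifold (R : realType) (n : nat) (M : topologicalType) :=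
  SmoothManifold {
  hausdorff_manifold : hausdorff_space M ;
  second_countable_manifold : @second_countable M ;
  atlas : set (chart R n M) ;
  atlas_cover : forall x : M, exists phi, atlas phi /\ chart_dom phi x ;
  atlas_smooth : forall phi psi, atlas phi -> atlas psi ->
    forall k, Ck_on k (phi @` (chart_dom phi `&` chart_dom psi))
                      (psi \o chart_inv phi)
}.

Definition bilin (R : realType) (n : nat) (G : 'M[R]_n) (u w : 'rV[R]_n) : R :=
  (u *m G *m w^T) ord0 ord0.

(* [metric phi y] is the matrix (g_ij) at the point with coordinates [y] in the
   chart [phi]; only charts of the atlas and [y] in [chart_ran phi] matter. *)
Record riemannian_metric (R : realType) (n : nat) (M : topologicalType)
    (S : smooth_manifold R n M) := RiemannianMetric {
  metric : chart R n M -> 'rV[R]_n -> 'M[R]_n ;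
  metric_smooth : forall phi, atlas S phi ->
    forall k, Ck_on k (chart_ran phi) (metric phi) ;
  metric_sym : forall phi y, atlas S phi -> chart_ran phi y ->
    (metric phi y)^T = metric phi y ;
  metric_posdef : forall phi y, atlas S phi -> chart_ran phi y ->
    forall u, u != 0 -> 0 < bilin (metric phi y) u u ;
  metric_transition : forall phi psi x, atlas S phi -> atlas S psi ->
    chart_dom phi x -> chart_dom psi x -> forall u w,
    bilin (metric phi (phi x)) u w =
    bilin (metric psi (psi x)) ('d (psi \o chart_inv phi) (phi x) u)
                               ('d (psi \o chart_inv phi) (phi x) w)
}.

Section SmoothMaps.
Context (R : realType) (n : nat) (M : topologicalType).
Context (S : smooth_manifold R n M).
Implicit Types (f : M -> M) (k : nat).

Definition Ck_map k f : Prop :=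
  continuous f /\
  forall phi psi, atlas S phi -> atlas S psi ->
    Ck_on k (phi @` (chart_dom phi `&` f @^-1` chart_dom psi))
            (psi \o f \o chart_inv phi).

Definition Ck_diffeo k f : Prop :=
  exists h, [/\ cancel f h, cancel h f, Ck_map k f & Ck_map k h].

Definition chart_at (x : M) : chart R n M := projT1 (cid (atlas_cover S x)).

(* T_x M is identified with 'rV_n through the chosen chart [chart_at x]. *)
Definition tangent_map f (x : M) (v : 'rV[R]_n) : 'rV[R]_n :=
  'd (chart_at (f x) \o f \o chart_inv (chart_at x)) (chart_at x x) v.

End SmoothMaps.

Section Riemannian.
Context (R : realType) (n : nat) (M : topologicalType).
Context (S : smooth_manifold R n M) (g : riemannian_metric S).
Implicit Types (f : M -> M) (x y z : M) (phi : chart R n M).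

Definition tangent_norm x (v : 'rV[R]_n) : R :=
  Num.sqrt (bilin (metric g (chart_at S x) (chart_at S x x)) v v).

Definition tangent_map_norm f x : R :=
  sup [set tangent_norm (f x) (tangent_map S f x v) |
       v in [set v | tangent_norm x v <= 1]].

(* C^1 on the closed interval [0, 1], i.e. C^1 on an open neighbourhood. *)
Definition C1_curve (c : R -> M) : Prop :=
  exists O : set R, [/\ open O, `[0, 1] `<=` O,
    forall t, O t -> {for t, continuous c} &
    forall phi, atlas S phi ->
      Ck_on 1 (O `&` c @^-1` chart_dom phi) (phi \o c)].

Definition curve_length (c : R -> M) : \bar R :=
  (\int[lebesgue_measure]_(t in `[0%R, 1%R])
     (tangent_norm (c t) (derive1 (chart_at S (c t) \o c) t))%:E)%E.

(* [piecewise_C1_length x y l]: some concatenation of finitely many C^1 curves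
   goes from [x] to [y] and has total length [l]. *)
Inductive piecewise_C1_length x : M -> \bar R -> Prop :=
| piecewise_C1_nil : piecewise_C1_length x x 0%E
| piecewise_C1_snoc (c : R -> M) l :
    piecewise_C1_length x (c 0) l -> C1_curve c ->
    piecewise_C1_length x (c 1) (l + curve_length c)%E.

(* The value is +oo between distinct connected components. *)
Definition riemannian_dist x y : \bar R :=
  ereal_inf [set l | piecewise_C1_length x y l].

(* Iterated integral over R^m; by Tonelli this is the integral with respect to
   m-dimensional Lebesgue measure for nonnegative Borel functions. *)
Fixpoint iterated_integral (m : nat) : ('rV[R]_m -> \bar R) -> \bar R :=
  match m return ('rV[R]_m -> \bar R) -> \bar R with
  | 0 => fun F => F 0
  | m'.+1 => fun F =>
      (\int[lebesgue_measure]_t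
         iterated_integral
           (fun y : 'rV[R]_m' => F (row_mx (const_mx t : 'rV[R]_1) y)))%E
  end.

Definition chart_volume phi (B : set M) : \bar R :=
  iterated_integral (fun u : 'rV[R]_n =>
    if u \in phi @` B then (Num.sqrt (\det (metric g phi u)))%:E else 0%E).

(* The Riemannian measure of a Borel set [A]. Chart volumes of a Borel set lying
   in several chart domains agree (change of variables) and, by second
   countability, [A] is a countable disjoint union of Borel sets each lying in
   one chart domain; the measure is the supremum of the partial sums. *)
Definition vol (A : set M) : \bar R :=
  ereal_sup [set v | exists (m : nat) (phi : 'I_m -> chart R n M)
                            (B : 'I_m -> set M),
    [/\ forall i, atlas S (phi i),
        forall i, <<s @open M >> (B i) /\ B i `<=` chart_dom (phi i) `&` A,
        trivIset setT B &
        v = (\sum_(i < m) chart_volume (phi i) (B i))%E]].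

Definition covering_number (L : set M) (e : R) : \bar R :=
  ereal_inf [set m%:R%:E | m in
    [set m : nat | exists p : 'I_m -> M,
       L `<=` \bigcup_i [set y | (riemannian_dist (p i) y < e%:E)%E]]].

Definition upper_box_dim (L : set M) : \bar R :=
  limf_esup (fun e : R => (lne (covering_number L e) / (- ln e)%:E)%E) 0^'+.

(* Largest cardinality of an (m, e)-separated subset of [L]. *)
Definition separation_number f (L : set M) (m : nat) (e : R) : \bar R :=
  ereal_sup [set N%:R%:E | N in
    [set N : nat | exists p : 'I_N -> M,
       (forall i, L (p i)) /\
       (forall i j, i != j -> exists2 k, (k < m)%N &
          (e%:E < riemannian_dist (iter k f (p i)) (iter k f (p j)))%E)]].

Definition top_entropy f (L : set M) : \bar R :=
  lim ((limn_esup (fun m =>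
          ((m%:R^-1)%:E * lne (separation_number f L m e))%E)) @[e --> 0^'+]).

Definition upper_lyapunov f x (v : 'rV[R]_n) : \bar R :=
  limn_esup (fun m =>
    (m%:R^-1 *
     ln (tangent_norm (iter m f x) (tangent_map S (iter m f) x v)))%:E).

Definition upper_escape_rate f (V : set M) : \bar R :=
  limn_esup (fun m =>
    ((m%:R^-1)%:E *
     lne (vol (\bigcap_(k in [set k | (k < m)%N]) (iter k f @^-1` V))))%E).

Definition expansion_rate f (L : set M) : R :=
  limn (fun m => m%:R^-1 *
    ln (sup [set tangent_map_norm (iter m f) x | x in L])).

End Riemannian.

(* [f^k(U)] for [k] in Z and an invertible map [f]. *)
Definition iter_image (M : Type) (f : M -> M) (k : int) (U : set M) : set M :=
  match k with
  | Posz m => iter m f @` U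
  | Negz m => iter m.+1 f @^-1` U
  end.

Definition isolating_nbhd (M : topologicalType) (f : M -> M) (L U : set M) :
    Prop :=
  [/\ open U, L `<=` U & L = \bigcap_k iter_image f k U].

Definition locally_maximal (M : topologicalType) (f : M -> M) (L : set M) :
    Prop :=
  exists U, isolating_nbhd f L U.

(* Main.v *)
Require Import Defs.
From HB Require Import structures.
From mathcomp Require Import all_boot all_order all_algebra.
From mathcomp Require Import all_classical all_reals all_analysis.
From mathcomp Require Import measurable_realfun ring lra.

Import Order.TTheory GRing.Theory Num.Theory.
Import numFieldNormedType.Exports.

Local Open Scope classical_set_scope.
Local Open Scope ring_scope.

Set Implicit Arguments.
Unset Strict Implicit.
Unset Printing Implicit Defensive.

(** Write [s] for the exponential rate at which the iterates of [f] expand along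
    [L], and [V_m] for the set of points whose first [m] iterates lie in [V].
    For any [s' > s], a point of [L] and a point at distance [r] from it separate
    at most by a constant times exp (m s') in [m] steps, as long as they stay
    close.  Hence if [r] is of the order of exp (- m s'), every ball of radius [r]
    centred on [L] is contained in [V_m] ([orbits_stay_close]).  A maximal family
    of points of [L] at mutual distance at least [2 r] covers [L] with balls of
    radius [2 r], while each of the balls of radius [r] contains a coordinate cube
    of volume at least a constant times [r ^ n], and these cubes are disjoint.  The covering number therefore satisfies
      N (2 r) * kappa * r ^ n <= vol V_m          ([covering_vol]),
    and taking logarithms with [- ln r] close to [m s'] bounds the upper box
    dimension by [n + E' / s'] for all [E'] above the escape rate and all
    [s' > s] ([upper_box_dim_le]).  Letting [E'] and [s'] decrease to their
    limits gives the inequality.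

    Three ingredients need the Riemannian structure.  The norm of the
    differential is upper semicontinuous ([opbound_near]), so a strict bound on
    [L] persists in a neighbourhood.  A path of small length starting on [L]
    stays in a prescribed neighbourhood ([tube]): a bump function in a chart is
    Lipschitz along curves, by the fundamental theorem of calculus, so leaving
    the chart costs a definite length.  With the previous point this shows that
    [f] expands small distances from [L] by a controlled factor
    ([dist_expansion]).  Finally, coordinate cubes are small in the Riemannian
    distance and have a volume bounded below ([small_cells]).

    The rate [s] is a limit by Fekete's lemma, and it is positive since the norm
    of the differential dominates the growth along the vector with a positive
    Lyapunov exponent ([expansion_rate_gt0]). *)

(** * Matrices as a normed space *)

Section Matrices.
Context (R : realType).

Lemma mx_entry_le m n (A : 'M[R]_(m, n)) i j : `|A i j| <= `|A|.
Proof.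
rewrite {2}/Num.Def.normr /= mx_normrE.
exact: (le_bigmax _ (fun k => `|A k.1 k.2|) (i, j)).
Qed.

Lemma mx_norm_le m n (A : 'M[R]_(m, n)) (c : R) :
  0 <= c -> (forall i j, `|A i j| <= c) -> `|A| <= c.
Proof.
by move=> c0 Ac; rewrite /Num.Def.normr /= mx_normrE; apply: bigmax_le.
Qed.

Lemma mx_norm_lt m n (A : 'M[R]_(m, n)) (c : R) :
  0 < c -> (forall i j, `|A i j| < c) -> `|A| < c.
Proof.
by move=> c0 Ac; rewrite /Num.Def.normr /= mx_normrE; apply: bigmax_lt.
Qed.

(** Matrices carry the maximum norm, so limits are entrywise. *)
Lemma cvg_mx (T : Type) (F : set_system T) (FF : Filter F) m n
    (f : T -> 'M[R]_(m, n)) (A : 'M[R]_(m, n)) :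
  (forall i j, f x i j @[x --> F] --> A i j) -> f x @[x --> F] --> A.
Proof.
move=> fA P [Q QA QP].
have : \forall x \near F, forall k : 'I_m * 'I_n, Q k.1 k.2 (f x k.1 k.2).
  apply: filter_forall => -[i j] /=; exact: fA (QA i j).
by apply: filterS => x Qx; apply: QP => i j; exact: (Qx (i, j)).
Qed.

Lemma cvg_entry (T : Type) (F : set_system T) (FF : Filter F) m n
    (f : T -> 'M[R]_(m, n)) (A : 'M[R]_(m, n)) i j :
  f x @[x --> F] --> A -> f x i j @[x --> F] --> A i j.
Proof.
move=> fA; apply: (@cvg_comp _ _ _ f (fun M : 'M[R]_(m, n) => M i j) F (nbhs A)).
  exact: fA.
exact: coord_continuous.
Qed.

Lemma cvg_sumr (T : Type) (F : set_system T) (FF : Filter F) (I : Type)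
    (V : normedModType R) (r : seq I) (f : I -> T -> V) (a : I -> V) :
  (forall i, f i x @[x --> F] --> a i) ->
  (\sum_(i <- r) f i x) @[x --> F] --> \sum_(i <- r) a i.
Proof.
move=> fa; elim: r => [|i r IH].
  by rewrite big_nil; under eq_fun do rewrite big_nil; exact: cvg_cst.
rewrite big_cons; under eq_fun do rewrite big_cons.
exact: cvgD.
Qed.

Lemma cvg_mulmx (T : Type) (F : set_system T) (FF : Filter F) m n p
    (f : T -> 'M[R]_(m, n)) (g : T -> 'M[R]_(n, p)) (A : 'M[R]_(m, n)) (B : 'M[R]_(n, p)) :
  f x @[x --> F] --> A -> g x @[x --> F] --> B ->
  (f x *m g x) @[x --> F] --> A *m B.
Proof.
move=> fA gB; apply: cvg_mx => i j; rewrite mxE.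
under eq_fun do rewrite mxE.
by apply: cvg_sumr => k; apply: cvgM; exact: cvg_entry.
Qed.

Lemma cvg_trmx (T : Type) (F : set_system T) (FF : Filter F) m n
    (f : T -> 'M[R]_(m, n)) (A : 'M[R]_(m, n)) :
  f x @[x --> F] --> A -> (f x)^T @[x --> F] --> A^T.
Proof.
move=> fA; apply: cvg_mx => i j; rewrite mxE.
by under eq_fun do rewrite mxE; exact: cvg_entry.
Qed.

Lemma cvg_bilin (T : Type) (F : set_system T) (FF : Filter F) n
    (G : T -> 'M[R]_n) (u w : T -> 'rV[R]_n)
    (G0 : 'M[R]_n) (u0 w0 : 'rV[R]_n) :
  G x @[x --> F] --> G0 -> u x @[x --> F] --> u0 -> w x @[x --> F] --> w0 ->
  bilin (G x) (u x) (w x) @[x --> F] --> bilin G0 u0 w0.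
Proof.
move=> cG cu cw; apply: cvg_entry; apply: cvg_mulmx; first exact: cvg_mulmx.
exact: cvg_trmx.
Qed.

Lemma cvg_dist (T : Type) (F : set_system T) (FF : Filter F) n
    (y : T -> 'rV[R]_n) (a z : 'rV[R]_n) :
  y s @[s --> F] --> z -> `|a - y s| @[s --> F] --> `|a - z|.
Proof. by move=> yz; apply: cvg_norm; apply: cvgB => //; exact: cvg_cst. Qed.

Lemma cvg_det (T : Type) (F : set_system T) (FF : Filter F) n
    (G : T -> 'M[R]_n) (G0 : 'M[R]_n) :
  G x @[x --> F] --> G0 -> \det (G x) @[x --> F] --> \det G0.
Proof.
move=> cG; rewrite /determinant; apply: cvg_sumr => s.
apply: cvgM; first exact: cvg_cst.
elim: (index_enum _) => [|i r IH].
  by rewrite big_nil; under eq_fun do rewrite big_nil; exact: cvg_cst.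
rewrite big_cons; under eq_fun do rewrite big_cons.
by apply: cvgM => //; exact: cvg_entry.
Qed.

Lemma bilinZ n (G : 'M[R]_n) (a : R) u :
  bilin G (a *: u) (a *: u) = a ^+ 2 * bilin G u u.
Proof.
by rewrite /bilin linearZ /= -scalemxAl -scalemxAr -scalemxAl !mxE mulrA expr2.
Qed.

Lemma bilin0 n (G : 'M[R]_n) : bilin G 0 0 = 0.
Proof. by rewrite /bilin !mul0mx mxE. Qed.

Lemma bilinD n (G H : 'M[R]_n) u : bilin (G + H) u u = bilin G u u + bilin H u u.
Proof. by rewrite /bilin mulmxDr mulmxDl mxE. Qed.

Lemma bilinZl n (a : R) (G : 'M[R]_n) u : bilin (a *: G) u u = a * bilin G u u.
Proof. by rewrite /bilin -scalemxAr -scalemxAl mxE. Qed.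

Lemma bilinB n (G H : 'M[R]_n) u : bilin (G - H) u u = bilin G u u - bilin H u u.
Proof. by rewrite -scaleN1r bilinD bilinZl mulN1r. Qed.

Lemma bilin_conj n p (G : 'M[R]_p) (J : 'M[R]_(n, p)) u :
  bilin (J *m G *m J^T) u u = bilin G (u *m J) (u *m J).
Proof. by rewrite /bilin trmx_mul !mulmxA. Qed.

Lemma bilin1 n (u : 'rV[R]_n) : bilin 1%:M u u = \sum_i u ord0 i ^+ 2.
Proof.
by rewrite /bilin mulmx1 mxE; apply: eq_bigr => i _; rewrite mxE expr2.
Qed.

(** By homogeneity it suffices to bound the form below on the unit sphere,
    which is compact, so that one neighbourhood serves all directions. *)
Lemma posdef_near (T : Type) (F : set_system T) (FF : Filter F) n
    (Q : T -> 'M[R]_n) (Q0 : 'M[R]_n) :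
  Q x @[x --> F] --> Q0 -> (forall u, u != 0 -> 0 < bilin Q0 u u) ->
  exists2 c : R, 0 < c &
    \forall x \near F, forall u, c * `|u| ^+ 2 <= bilin (Q x) u u.
Proof.
move=> cQ pos.
pose S := [set u : 'rV[R]_n | `|u| = 1].
have cS : compact S.
  apply: bounded_closed_compact.
    exists 1; split; first exact: num_real.
    by move=> x x1 u /= ->; exact: ltW.
  rewrite (_ : S = (fun u : 'rV[R]_n => `|u|) @^-1` [set 1]) //.
  apply: closed_comp; last exact: closed_eq.
  by move=> u _; exact: norm_continuous.
move/compact_near_coveringP : cS.
move=> /(_ _ (filter_prod F (0 : R)^'+) (fun i u => i.2 < bilin (Q i.1) u u) _).
case.
  move=> u Su.
  have u0 : u != 0 by rewrite -normr_gt0 Su.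
  have p0 := pos _ u0.
  have H : \forall p \near (nbhs u, F),
      bilin Q0 u u / 2 < bilin (Q p.2) p.1 p.1.
    have cv : bilin (Q p.2) p.1 p.1 @[p --> (nbhs u, F)] --> bilin Q0 u u.
      apply: cvg_bilin; last exact: cvg_fst.
        exact: cvg_comp cvg_snd cQ.
      exact: cvg_fst.
    by apply: (cvgr_gt _ cv); rewrite ltr_pdivrMr// ltr_pMr// ltr1n.
  case: H => -[A B] /= [Au BF] AB.
  exists (A, B `*` [set c | c < bilin Q0 u u / 2]) => /=.
    split => //; exists (B, [set c | c < bilin Q0 u u / 2]) => //=.
    by split => //; apply: nbhs_right_lt; rewrite divr_gt0.
  move=> [v [y c]] /= [Av [By clt]]; apply: (lt_trans clt).
  exact: (AB (v, y)).
move=> [A B] /= [AF B0] AB.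
have [c [c0 Bc]] : exists c, 0 < c /\ B c.
  near (0 : R)^'+ => c; exists c; split.
    by near: c; exact: nbhs_right_gt.
  by near: c.
exists c => //; apply: filterS AF => x Ax u.
have [->|u0] := eqVneq u 0; first by rewrite normr0 bilin0 expr0n mulr0.
have nu : 0 < `|u| by rewrite normr_gt0.
have := AB (x, c) (conj Ax Bc) (`|u|^-1 *: u).
rewrite /S /= => /(_ _)/ltW.
rewrite bilinZ exprVn mulrC ler_pdivlMr ?exprn_gt0//; apply.
by rewrite normrZ normfV normr_id mulVf// gt_eqF.
Unshelve. all: by end_near. Qed.

Lemma bilin_le n (G : 'M[R]_n) u : bilin G u u <= (n ^ 2)%:R * `|G| * `|u| ^+ 2.
Proof.
rewrite /bilin mxE.
apply: le_trans (_ : \sum_(j < n) \sum_(i < n) `|G| * `|u| ^+ 2 <= _); last first.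
  by rewrite !sumr_const !card_ord -mulrnA -mulnn -mulrA mulr_natl.
apply: ler_sum => j _; rewrite mxE mulr_suml; apply: ler_sum => i _.
rewrite mxE mulrAC mulrC expr2; apply: le_trans (ler_norm _) _.
rewrite normrM; apply: ler_pM => //; first exact: mx_entry_le.
by rewrite normrM; apply: ler_pM => //; exact: mx_entry_le.
Qed.

Lemma bilin_near_le (T : Type) (F : set_system T) (FF : Filter F) n
    (Q : T -> 'M[R]_n) (Q0 : 'M[R]_n) :
  Q x @[x --> F] --> Q0 ->
  exists2 K : R, 0 < K &
    \forall x \near F, forall u, bilin (Q x) u u <= K * `|u| ^+ 2.
Proof.
move=> cQ; exists ((n ^ 2)%:R * (`|Q0| + 1) + 1).
  by rewrite ltr_wpDl// mulr_ge0// addr_ge0.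
have : \forall x \near F, `|Q x| < `|Q0| + 1.
  have cv : `|Q x| @[x --> F] --> `|Q0|.
    exact: cvg_norm cQ.
  by apply: (cvgr_lt _ cv); rewrite ltrDl.
apply: filterS => x Qx u; apply: (le_trans (bilin_le _ _)).
apply: ler_wpM2r; first exact: exprn_ge0.
by rewrite ler_wpDr// ler_wpM2l// ltW.
Qed.

(** The segment from the identity to a positive definite matrix consists of
    invertible matrices, so the determinant cannot change sign along it. *)
Lemma posdef_det_gt0 n (G : 'M[R]_n) :
  (forall u, u != 0 -> 0 < bilin G u u) -> 0 < \det G.
Proof.
move=> pos.
pose P (t : R) := (1 - t) *: 1%:M + t *: G.
have P_unit t : 0 <= t <= 1 -> \det (P t) != 0.
  move=> /andP[t0 t1]; apply/eqP => /eqP /det0P[v v0 Pv].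
  have : bilin (P t) v v = 0 by rewrite /bilin Pv mul0mx mxE.
  rewrite bilinD !bilinZl.
  have b1 : 0 < bilin 1%:M v v.
    rewrite bilin1 lt_neqAle sumr_ge0 ?andbT; last by move=> i _; exact: sqr_ge0.
    rewrite eq_sym psumr_eq0; last by move=> i _; exact: sqr_ge0.
    apply: contra v0 => /allP v0; apply/eqP/rowP => i; rewrite mxE.
    by have := v0 i (mem_index_enum _); rewrite sqrf_eq0 => /eqP.
  have b2 := pos _ v0.
  move: t0; rewrite le_eqVlt => /orP[/eqP <-|t0].
    by rewrite subr0 mul1r mul0r addr0 => H; rewrite H ltxx in b1.
  move=> H; suff : 0 < (1 - t) * bilin 1%:M v v + t * bilin G v v.
    by rewrite H ltxx.
  by rewrite ltr_wpDl ?mulr_gt0// mulr_ge0 ?subr_ge0// ltW.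
have cP : continuous (fun t => \det (P t)).
  move=> t; apply: cvg_det; apply: cvgD.
    apply: cvgZ; last exact: cvg_cst.
    by apply: cvgB; [exact: cvg_cst|exact: cvg_id].
  by apply: cvgZ; [exact: cvg_id|exact: cvg_cst].
rewrite ltNge; apply/negP => dG.
have P0 : \det (P 0) = 1 by rewrite /P subr0 scale1r scale0r addr0 det1.
have P1 : \det (P 1) = \det G by rewrite /P subrr scale1r scale0r add0r.
have [||c] := @IVT R (fun t => \det (P t)) 0 1 0 ler01.
- exact: continuous_subspaceT.
- by rewrite P0 P1 ge_min le_max ler01 dG orbT.
- rewrite in_itv /= => c01 Pc; have := P_unit c c01.
  by rewrite Pc eqxx.
Qed.

End Matrices.

(** * Pointwise C^1 regularity *)

Section C1.
Context (R : realType).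

Lemma cvg_near_eq (T : Type) (U : topologicalType) (F : set_system T)
    (FF : Filter F) (f g : T -> U) (l : U) :
  (\forall x \near F, f x = g x) -> f x @[x --> F] --> l ->
  g x @[x --> F] --> l.
Proof.
move=> fg; apply: cvg_trans; apply: near_eq_cvg.
by apply: filterS fg => x ->.
Qed.

(** Differentiability is a property of the germ: the same linear map is a
    differential of both functions. *)
Lemma near_eq_differentiable (V W : normedModType R) (f g : V -> W) (x : V) :
  (\forall y \near x, f y = g y) -> differentiable f x -> differentiable g x.
Proof.
move=> fg /diff_locallyP[cd E].
have fgx : f x = g x by exact: nbhs_singleton fg.
have E' : g \o shift x = cst (g x) + 'd f x +o_ (0 : V) id.
  apply/eqaddoP => e e0.
  have /eqaddoP /(_ e e0) := E.
  move: fg; rewrite (near_shift (0 : V)) /= subr0 => fg.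
  apply: filterS2 fg => h Eh; rewrite -fgx /= in Eh *.
  by rewrite -[(g \o _ - _) h]/(g (h + x) - (cst (f x) + 'd f x) h) -Eh.
by apply/diff_locallyP; rewrite (diff_unique cd E').
Qed.

(** The pointwise form of C^1 regularity composes without any bookkeeping of open
    domains, which is convenient for coordinate expressions. *)
Definition C1_at (V W : normedModType R) (f : V -> W) (x : V) :=
  (\forall y \near x, differentiable f y) /\
  forall v, {for x, continuous (fun y => 'D_v f y)}.

Lemma C1_at_diff (V W : normedModType R) (f : V -> W) (x : V) :
  C1_at f x -> differentiable f x.
Proof. by case=> /nbhs_singleton. Qed.

Lemma C1_at_near (V W : normedModType R) (f g : V -> W) (x : V) :
  (\forall y \near x, f y = g y) -> C1_at f x -> C1_at g x.
Proof.
move=> fg [df cf]; have fg2 := near_join fg; split.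
  near=> y; apply: (@near_eq_differentiable _ _ f); first by near: y.
  by near: y.
move=> v; suff : 'D_v g y @[y --> x] --> 'D_v g x by [].
rewrite -(near_eq_derive v fg).
apply: (cvg_near_eq _ _ (cf v)).
by apply: filterS fg2 => y fgy; apply: near_eq_derive.
Unshelve. all: by end_near. Qed.

Lemma derive_comp n (V W : normedModType R) (f : V -> 'rV[R]_n)
    (g : 'rV[R]_n -> W) x v :
  differentiable f x -> differentiable g (f x) ->
  'D_v (g \o f) x = 'd g (f x) ('D_v f x).
Proof.
move=> df dg; rewrite (deriveE _ df) deriveE; last exact: differentiable_comp.
by rewrite diff_comp.
Qed.

Lemma diff_sum_deriv n (W : normedModType R) (g : 'rV[R]_n -> W) y u :
  differentiable g y ->
  'd g y u = \sum_i u ord0 i *: 'D_(delta_mx ord0 i) g y.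
Proof.
move=> dg; rewrite {1}[u]row_sum_delta linear_sum; apply: eq_bigr => i _.
by rewrite linearZ deriveE.
Qed.

(** Expanding the inner derivative in the canonical basis expresses the
    directional derivative of a composite as a finite sum of products of
    continuous functions. *)
Lemma C1_at_comp n (V W : normedModType R) (f : V -> 'rV[R]_n)
    (g : 'rV[R]_n -> W) x :
  C1_at f x -> C1_at g (f x) -> C1_at (g \o f) x.
Proof.
move=> Cf Cg; have fx := differentiable_continuous (C1_at_diff Cf).
case: Cf Cg => [df cf] [dg cg].
have dgf : \forall y \near x, differentiable g (f y) by exact: (fx _ dg).
split; first by apply: filterS2 df dgf => y; exact: differentiable_comp.
move=> v; suff : 'D_v (g \o f) y @[y --> x] --> 'D_v (g \o f) x by [].
pose h y := \sum_i ('D_v f y) ord0 i *: 'D_(delta_mx ord0 i) g (f y).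
have hE : \forall y \near x, h y = 'D_v (g \o f) y.
  apply: filterS2 df dgf => y dfy dgy.
  by rewrite derive_comp// diff_sum_deriv.
rewrite -(nbhs_singleton hE); apply: cvg_near_eq hE _.
apply: cvg_sumr => i; apply: cvgZ.
  apply: cvg_entry; exact: cf.
exact: (@cvg_comp _ _ _ f (fun y => 'D_(delta_mx ord0 i) g y) _ (nbhs (f x)) _
         fx (cg _)).
Qed.

Lemma Ck_on_C1_at (V W : normedModType R) k (O : set V) (f : V -> W) x :
  open O -> Ck_on k.+1 O f -> O x -> C1_at f x.
Proof.
move=> oO [df H] Ox; split.
  by apply: filterS (open_nbhs_nbhs (conj oO Ox)) => y; exact: df.
move=> v; have := H v => {H}; elim: k f df => [|k IH] f df.
  exact.
by move=> [dD _]; exact/differentiable_continuous/dD.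
Qed.

Lemma C1_at_Ck_on (V W : normedModType R) (O : set V) (f : V -> W) :
  (forall x, O x -> C1_at f x) -> Ck_on 1 O f.
Proof.
move=> H; split=> [x /H/C1_at_diff//|v x Ox]; exact: (H x Ox).2.
Qed.

Lemma C1_at_jacobian_cvg n m (f : 'rV[R]_n -> 'rV[R]_m) x :
  C1_at f x -> jacobian f y @[y --> x] --> jacobian f x.
Proof.
move=> [df cf]; apply: (@cvg_mx R _ (nbhs x) _ n m (jacobian f)) => i j.
pose h y := 'D_(delta_mx ord0 i) f y ord0 j.
have hE : \forall y \near x, h y = jacobian f y i j.
  by apply: filterS df => y dfy; rewrite /h deriveE// /jacobian mxE.
have hx : h x = jacobian f x i j := nbhs_singleton hE.
have hc : h y @[y --> x] --> h x.
  exact: (@cvg_entry R _ (nbhs x) _ 1 m (fun y => 'D_(delta_mx ord0 i) f y) _ _ _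
         (cf _)).
have := @cvg_near_eq _ R (nbhs x) _ h (fun y => jacobian f y i j) (h x) hE hc.
rewrite hx.
exact.
Qed.

Lemma is_diff_affine (V : normedModType R) (a b : V) (t : R) :
  is_diff t (fun s : R => a + s *: b) (fun v => v *: b).
Proof.
have := is_diffD (is_diff_cst a t) (is_diff_scalel t b).
by rewrite add0r.
Qed.

Lemma derive_affine (V : normedModType R) (a b : V) (t v : R) :
  'D_v (fun s : R => a + s *: b) t = v *: b.
Proof.
have ida := is_diff_affine a b t.
by rewrite deriveE ?diff_val//; exact: ex_diff.
Qed.

Lemma C1_at_affine (V : normedModType R) (a b : V) (t : R) :
  C1_at (fun s : R => a + s *: b) t.
Proof.
split; last move=> v.
  apply: filterE => s.
  exact: (@ex_diff _ _ _ _ _ _ _ (is_diff_affine a b s)).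
rewrite (_ : (fun y => _) = cst (v *: b)); first exact: cst_continuous.
by apply/funext => s; rewrite derive_affine.
Qed.

End C1.

(** * C^1 maps and operator norms of their differentials *)

Section Charts.
Context (R : realType) (n : nat) (M : topologicalType).
Implicit Types phi psi : chart R n M.

Lemma chart_dom_nbhs phi x : chart_dom phi x -> \forall y \near x, chart_dom phi y.
Proof. by move=> dx; apply: open_nbhs_nbhs; split=> //; exact: chart_dom_open. Qed.

Lemma chart_ran_nbhs phi x : chart_dom phi x ->
  \forall y \near phi x, chart_ran phi y.
Proof.
move=> dx; apply: open_nbhs_nbhs; split; first exact: chart_ran_open.
by exists x.
Qed.

Lemma chart_inv_cvg phi x : chart_dom phi x ->
  chart_inv phi y @[y --> phi x] --> x.
Proof.
move=> dx; suff : chart_inv phi y @[y --> phi x] --> chart_inv phi (phi x).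
  by rewrite chart_mapK.
by apply: chart_inv_continuous; exists x.
Qed.

Lemma chart_invK phi y : chart_ran phi y -> phi (chart_inv phi y) = y.
Proof. by move=> [x dx <-]; rewrite chart_mapK. Qed.

Lemma chart_inv_dom phi y : chart_ran phi y -> chart_dom phi (chart_inv phi y).
Proof. by move=> [x dx <-]; rewrite chart_mapK. Qed.

Lemma chart_image_open phi (A : set M) :
  (forall x, chart_dom phi x -> A x -> nbhs x A) ->
  open (phi @` (chart_dom phi `&` A)).
Proof.
move=> oA; rewrite openE => _ [x [dx Ax] <-].
have := chart_inv_cvg dx (oA _ dx Ax).
have := chart_ran_nbhs dx; apply: filterS2 => _ [z dz <-] /=.
by rewrite chart_mapK// => Az; exists z.
Qed.

End Charts.

Section Maps.
Context (R : realType) (n : nat) (M : topologicalType).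
Context (S : smooth_manifold R n M).
Implicit Types (f F H : M -> M) (phi chi psi : chart R n M).

(** Unlike [Ck_map], this form refers to points rather than to open subsets of
    the charts, so that it passes to composites and iterates. *)
Definition C1_map F := continuous F /\
  forall phi psi x, atlas S phi -> atlas S psi ->
    chart_dom phi x -> chart_dom psi (F x) ->
    C1_at (psi \o F \o chart_inv phi) (phi x).

Lemma Ck_map_C1 k f : Ck_map S k.+1 f -> C1_map f.
Proof.
move=> [cf H]; split=> // phi psi x ap aq dx dfx.
apply: (Ck_on_C1_at _ (H _ _ ap aq)); last by exists x.
apply: chart_image_open => y dy dfy; apply: cf.
exact: chart_dom_nbhs.
Qed.

Lemma C1_map_id : C1_map id.
Proof.
split; first by move=> x; exact: cvg_id.
move=> phi psi x ap aq dx dfx.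
apply: (Ck_on_C1_at _ (atlas_smooth ap aq 1)); last by exists x.
by apply: chart_image_open => y dy dfy; exact: chart_dom_nbhs.
Qed.

Lemma rep_comp_near phi chi psi F H x : continuous H ->
  chart_dom phi x -> chart_dom chi (H x) ->
  \forall y \near phi x,
   ((psi \o F \o chart_inv chi) \o (chi \o H \o chart_inv phi)) y =
   (psi \o (F \o H) \o chart_inv phi) y.
Proof.
move=> cH dx dHx.
have : \forall y \near phi x, chart_dom chi (H (chart_inv phi y)).
  exact: (chart_inv_cvg dx (cH x _ (chart_dom_nbhs dHx))).
by apply: filterS => y dy /=; rewrite chart_mapK.
Qed.

Lemma chart_at_atlas x : atlas S (chart_at S x).
Proof. by rewrite /chart_at; case: cid => phi []. Qed.

Lemma chart_at_dom x : chart_dom (chart_at S x) x.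
Proof. by rewrite /chart_at; case: cid => phi []. Qed.

Hint Resolve chart_at_atlas chart_at_dom : core.

Lemma C1_map_comp F H : C1_map F -> C1_map H -> C1_map (F \o H).
Proof.
move=> [cF DF] [cH DH]; split.
  by move=> x; exact: continuous_comp (cH x) (cF (H x)).
move=> phi psi x ap aq dx dfx.
have dH := chart_at_dom (H x).
apply: C1_at_near (rep_comp_near psi F cH dx dH) _.
apply: C1_at_comp; first exact: DH.
by rewrite /= chart_mapK//; exact: DF.
Qed.

Lemma C1_map_iter F k : C1_map F -> C1_map (iter k F).
Proof.
move=> CF; elim: k => [|k IH]; first exact: C1_map_id.
exact: (C1_map_comp CF IH).
Qed.

(** The chain rule for coordinate expressions; with [F] or [H] the identity it
    expresses the change of chart of a differential. *)
Lemma rep_chain phi chi psi F H x v : C1_map F -> C1_map H ->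
  atlas S phi -> atlas S chi -> atlas S psi ->
  chart_dom phi x -> chart_dom chi (H x) -> chart_dom psi (F (H x)) ->
  'd (psi \o (F \o H) \o chart_inv phi) (phi x) v =
  'd (psi \o F \o chart_inv chi) (chi (H x))
     ('d (chi \o H \o chart_inv phi) (phi x) v).
Proof.
move=> CF CH ap ac aq dx dH dFH.
have CFH := C1_map_comp CF CH.
have d1 := C1_at_diff (CFH.2 _ _ _ ap aq dx dFH).
have d2 := C1_at_diff (CH.2 _ _ _ ap ac dx dH).
have d3 := C1_at_diff (CF.2 _ _ _ ac aq dH dFH).
rewrite -[LHS](deriveE v d1) -[X in _ = 'd _ _ X](deriveE v d2).
rewrite -(near_eq_derive _ (rep_comp_near psi F CH.1 dx dH)).
have e : (chi \o H \o chart_inv phi) (phi x) = chi (H x).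
  by rewrite /= chart_mapK.
by rewrite derive_comp ?e.
Qed.

Lemma C1_map_diff F phi psi x : C1_map F -> atlas S phi -> atlas S psi ->
  chart_dom phi x -> chart_dom psi (F x) ->
  differentiable (psi \o F \o chart_inv phi) (phi x).
Proof. by move=> CF *; apply: C1_at_diff; exact: CF.2. Qed.

Lemma rep_jacobian F phi psi x v : C1_map F -> atlas S phi -> atlas S psi ->
  chart_dom phi x -> chart_dom psi (F x) ->
  'd (psi \o F \o chart_inv phi) (phi x) v =
  v *m jacobian (psi \o F \o chart_inv phi) (phi x).
Proof.
move=> CF ap aq dx dF; have df := C1_map_diff CF ap aq dx dF.
by rewrite -(deriveEjacobian v df) (deriveE v df).
Qed.

Lemma tangent_map_jacobian F x v : C1_map F ->
  tangent_map S F x v =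
  v *m jacobian (chart_at S (F x) \o F \o chart_inv (chart_at S x))
                (chart_at S x x).
Proof. by move=> CF; exact: rep_jacobian. Qed.

Lemma tangent_map_comp F H x v : C1_map F -> C1_map H ->
  tangent_map S (F \o H) x v = tangent_map S F (H x) (tangent_map S H x v).
Proof.
move=> CF CH.
exact: (@rep_chain (chart_at S x) (chart_at S (H x)) (chart_at S (F (H x))) F H).
Qed.

End Maps.

#[global] Hint Resolve chart_at_atlas chart_at_dom : core.

Section Norms.
Context (R : realType) (n : nat) (M : topologicalType).
Context (S : smooth_manifold R n M) (g : riemannian_metric S).
Implicit Types (f F H : M -> M) (phi chi psi : chart R n M).

Definition chart_norm phi x (v : 'rV[R]_n) : R :=
  Num.sqrt (bilin (metric g phi (phi x)) v v).

Lemma chart_norm_trans phi psi x v : atlas S phi -> atlas S psi ->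
  chart_dom phi x -> chart_dom psi x ->
  chart_norm phi x v = chart_norm psi x ('d (psi \o chart_inv phi) (phi x) v).
Proof. by move=> ap aq dx dy; rewrite /chart_norm (metric_transition _ ap aq). Qed.

Lemma metric_ge0 phi x v : atlas S phi -> chart_dom phi x ->
  0 <= bilin (metric g phi (phi x)) v v.
Proof.
move=> ap dx; have [->|v0] := eqVneq v 0; first by rewrite bilin0.
by apply/ltW/metric_posdef => //; exists x.
Qed.

Lemma metric_gt0 phi x v : atlas S phi -> chart_dom phi x -> v != 0 ->
  0 < bilin (metric g phi (phi x)) v v.
Proof. by move=> ap dx v0; apply: metric_posdef => //; exists x. Qed.

Lemma metric_cvg phi x : atlas S phi -> chart_dom phi x ->
  metric g phi y @[y --> phi x] --> metric g phi (phi x).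
Proof. by move=> ap dx; apply: (metric_smooth g ap 0); exists x. Qed.

Lemma metric_cvgM phi x : atlas S phi -> chart_dom phi x ->
  metric g phi (phi y) @[y --> x] --> metric g phi (phi x).
Proof.
move=> ap dx.
apply: (@cvg_comp _ _ _ phi (metric g phi) _ (nbhs (phi x))).
  exact: chart_map_continuous.
exact: metric_cvg.
Qed.

Lemma tangent_norm_ge0 x v : 0 <= tangent_norm g x v.
Proof. exact: sqrtr_ge0. Qed.

Lemma tangent_norm_gt0 x v : v != 0 -> 0 < tangent_norm g x v.
Proof. by move=> v0; rewrite sqrtr_gt0 metric_gt0. Qed.

Lemma tangent_normZ x a v : tangent_norm g x (a *: v) = `|a| * tangent_norm g x v.
Proof. by rewrite /tangent_norm bilinZ sqrtrM ?sqr_ge0// sqrtr_sqr. Qed.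

Lemma tangent_norm0 x : tangent_norm g x 0 = 0.
Proof. by rewrite /tangent_norm bilin0 sqrtr0. Qed.

(** The coordinates in [phi] of a tangent vector at [x], which is by convention
    given in the chosen chart [chart_at S x]. *)
Definition to_chart phi x (v : 'rV[R]_n) : 'rV[R]_n :=
  'd (phi \o chart_inv (chart_at S x)) (chart_at S x x) v.

Lemma tangent_normE phi x v : atlas S phi -> chart_dom phi x ->
  tangent_norm g x v = chart_norm phi x (to_chart phi x v).
Proof.
by move=> ap dx; exact: (chart_norm_trans v (chart_at_atlas S x) ap (chart_at_dom S x) dx).
Qed.

(** The norm of the image of a tangent vector can be read in any pair of charts:
    this replaces the charts [chart_at], which depend discontinuously on the
    point, by charts that are fixed near [x]. *)
Lemma tangent_mapE F phi psi x v : C1_map S F -> atlas S phi -> atlas S psi ->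
  chart_dom phi x -> chart_dom psi (F x) ->
  tangent_norm g (F x) (tangent_map S F x v) =
  chart_norm psi (F x)
    ('d (psi \o F \o chart_inv phi) (phi x) (to_chart phi x v)).
Proof.
move=> CF ap aq dx dF.
apply: etrans (tangent_normE (tangent_map S F x v) aq dF) _.
apply: (congr1 (chart_norm psi (F x))).
apply: etrans (@rep_chain _ _ _ S (chart_at S x) phi psi F id x v CF
  (C1_map_id S) (chart_at_atlas S x) ap aq (chart_at_dom S x) dx dF).
exact: esym (@rep_chain _ _ _ S (chart_at S x) (chart_at S (F x)) psi id F x v
  (C1_map_id S) CF (chart_at_atlas S x) (chart_at_atlas S (F x)) aq
  (chart_at_dom S x) (chart_at_dom S (F x)) dF).
Qed.

(** A bound on the operator norm stated vector by vector composes directly and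
    does not presuppose that the supremum defining the norm is finite. *)
Definition opbound F x A :=
  forall v, tangent_norm g (F x) (tangent_map S F x v) <= A * tangent_norm g x v.

Lemma opbound_le F x A B : A <= B -> opbound F x A -> opbound F x B.
Proof.
move=> AB H v; apply: le_trans (H v) _; apply: ler_wpM2r => //.
exact: tangent_norm_ge0.
Qed.

Lemma opbound_comp F H x A B : C1_map S F -> C1_map S H -> 0 <= A ->
  opbound F (H x) A -> opbound H x B -> opbound (F \o H) x (A * B).
Proof.
move=> CF CH A0 hF hH v; rewrite tangent_map_comp//.
by apply: le_trans (hF _) _; rewrite -mulrA ler_wpM2l.
Qed.

Lemma tangent_map0 F x : tangent_map S F x 0 = 0.
Proof. by rewrite /tangent_map linear0. Qed.

Lemma tangent_mapZ F x a v :
  tangent_map S F x (a *: v) = a *: tangent_map S F x v.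
Proof. by rewrite /tangent_map linearZ. Qed.

(** Positive definite forms in finite dimension are comparable to the square of
    the norm, which bounds the differential at a single point. *)
Lemma opbound_ex F x : C1_map S F -> exists2 A, 0 < A & opbound F x A.
Proof.
move=> CF; set phi := chart_at S x; set psi := chart_at S (F x).
pose J := jacobian (psi \o F \o chart_inv phi) (phi x).
have [c c0 cP] : exists2 c, 0 < c &
    forall u, c * `|u| ^+ 2 <= bilin (metric g phi (phi x)) u u.
  have [|c c0 /nbhs_singleton cP] := @posdef_near R _ (nbhs x) _ n _ _
    (metric_cvgM (chart_at_atlas S x) (chart_at_dom S x)).
    by move=> u; exact: metric_gt0.
  by exists c.
have [K K0 KP] : exists2 K : R, 0 < K &
    forall u, bilin (J *m metric g psi (psi (F x)) *m J^T) u u <= K * `|u| ^+ 2.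
  exists ((n ^ 2)%:R * `|J *m metric g psi (psi (F x)) *m J^T| + 1).
    by rewrite ltr_wpDl// mulr_ge0.
  move=> u; apply: (le_trans (bilin_le _ _)); apply: ler_wpM2r.
    exact: exprn_ge0.
  by rewrite lerDl.
exists (Num.sqrt (K / c)); first by rewrite sqrtr_gt0 divr_gt0.
move=> v; rewrite /tangent_norm -sqrtrM; last by rewrite divr_ge0 ?(ltW K0) ?(ltW c0).
apply: ler_wsqrtr.
rewrite (tangent_map_jacobian x v CF) -bilin_conj.
apply: (le_trans (KP v)); rewrite -mulrA ler_pM2l// mulrC ler_pdivlMr//.
by rewrite mulrC.
Qed.

Lemma tangent_map_norm_has_sup F x : C1_map S F ->
  has_sup [set tangent_norm g (F x) (tangent_map S F x v) |
       v in [set v | tangent_norm g x v <= 1]].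
Proof.
move=> CF; split.
  by exists (tangent_norm g (F x) (tangent_map S F x 0)), 0 => //=;
     rewrite tangent_norm0.
have [A A0 HA] := opbound_ex x CF.
exists A => _ [v /= v1 <-]; apply: le_trans (HA v) _.
by rewrite ler_piMr// ltW.
Qed.

Lemma opbound_norm F x : C1_map S F -> opbound F x (tangent_map_norm g F x).
Proof.
move=> CF v; have [->|v0] := eqVneq v 0.
  by rewrite tangent_map0 !tangent_norm0 mulr0.
have tv := tangent_norm_gt0 x v0.
rewrite -ler_pdivrMr//.
apply: (sup_upper_bound (tangent_map_norm_has_sup x CF)).
exists ((tangent_norm g x v)^-1 *: v) => /=.
  by rewrite tangent_normZ normfV gtr0_norm// mulVf// gt_eqF.
by rewrite tangent_mapZ tangent_normZ normfV gtr0_norm// mulrC.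
Qed.

Lemma norm_opbound F x A : C1_map S F -> 0 <= A -> opbound F x A ->
  tangent_map_norm g F x <= A.
Proof.
move=> CF A0 H; apply: ge_sup.
  by exists (tangent_norm g (F x) (tangent_map S F x 0)), 0 => //=;
     rewrite tangent_norm0.
by move=> _ [v /= v1 <-]; apply: le_trans (H v) _; rewrite ler_piMr.
Qed.

Lemma tangent_map_norm_ge0 F x : C1_map S F -> 0 <= tangent_map_norm g F x.
Proof.
move=> CF; apply: (sup_upper_bound (tangent_map_norm_has_sup x CF)).
by exists 0; rewrite /= ?tangent_map0 tangent_norm0.
Qed.

(** Upper semicontinuity of the operator norm: in fixed charts the quadratic
    form A^2 |u|^2 - |DF(y) u|^2 depends continuously on [y] and is positive
    definite at [x], hence nearby. *)
Lemma opbound_near F x A : C1_map S F -> tangent_map_norm g F x < A ->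
  \forall y \near x, opbound F y A.
Proof.
move=> CF BA; set B := tangent_map_norm g F x in BA.
have B0 : 0 <= B by exact: tangent_map_norm_ge0.
have A0 : 0 < A by exact: le_lt_trans BA.
have HB : opbound F x B by exact: opbound_norm.
set phi := chart_at S x; set psi := chart_at S (F x).
have CP := CF.2 phi psi x (chart_at_atlas S _) (chart_at_atlas S _)
  (chart_at_dom S _) (chart_at_dom S _).
pose J y := jacobian (psi \o F \o chart_inv phi) (phi y).
pose Q y := A ^+ 2 *: metric g phi (phi y)
            - J y *m metric g psi (psi (F y)) *m (J y)^T.
have cJ : J y @[y --> x] --> J x.
  apply: (@cvg_comp _ _ _ phi (jacobian (psi \o F \o chart_inv phi)) _
            (nbhs (phi x))); first exact: (chart_map_continuous (chart_at_dom S x)).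
  exact: C1_at_jacobian_cvg.
have cQ : Q y @[y --> x] --> Q x.
  apply: cvgB.
    apply: cvgZ; first exact: cvg_cst.
    exact: (metric_cvgM (chart_at_atlas S x) (chart_at_dom S x)).
  apply: cvg_mulmx; last exact: cvg_trmx cJ.
  apply: cvg_mulmx => //.
  apply: (@cvg_comp _ _ _ F (metric g psi \o psi) _ (nbhs (F x))).
    exact: CF.1.
  exact: (metric_cvgM (chart_at_atlas S (F x)) (chart_at_dom S (F x))).
have posQ u : u != 0 -> 0 < bilin (Q x) u u.
  move=> u0; rewrite bilinB bilinZl bilin_conj subr_gt0.
  have g0 := metric_gt0 (chart_at_atlas S x) (chart_at_dom S x) u0.
  apply: (@le_lt_trans _ _ (B ^+ 2 * bilin (metric g phi (phi x)) u u)).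
    have := HB u; rewrite -ler_sqr ?nnegrE ?mulr_ge0 ?tangent_norm_ge0//.
    rewrite exprMn /tangent_norm !sqr_sqrtr ?metric_ge0//.
    by rewrite (tangent_map_jacobian x u CF).
  by rewrite ltr_pM2r// ltr_sqr// nnegrE ltW.
have [c c0 cP] := posdef_near _ cQ posQ.
have d1 : \forall y \near x, chart_dom psi (F y).
  exact: (CF.1 x _ (chart_dom_nbhs (chart_at_dom S (F x)))).
near=> y => v.
have dy : chart_dom phi y by near: y; exact: (chart_dom_nbhs (chart_at_dom S x)).
have dFy : chart_dom psi (F y) by near: y.
rewrite (tangent_normE v (chart_at_atlas S x) dy).
rewrite (tangent_mapE v CF (chart_at_atlas S x) (chart_at_atlas S (F x)) dy dFy).
set u := to_chart _ _ _.
rewrite -[A]gtr0_norm// -sqrtr_sqr -sqrtrM ?sqr_ge0//; apply: ler_wsqrtr.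
rewrite (rep_jacobian u CF (chart_at_atlas S x) (chart_at_atlas S (F x)) dy dFy).
rewrite -bilin_conj -subr_ge0 -bilinZl -bilinB.
apply: le_trans (_ : c * `|u| ^+ 2 <= _).
  by rewrite mulr_ge0 ?exprn_ge0// ltW.
by move: (u); near: y.
Unshelve. all: by end_near. Qed.

End Norms.

(** * Curves and their lengths *)

Section Curves.
Context (R : realType) (n : nat) (M : topologicalType).
Context (S : smooth_manifold R n M) (g : riemannian_metric S).
Implicit Types (F : M -> M) (phi psi : chart R n M) (c : R -> M).

(** As [C1_at], a pointwise form of the regularity of a curve. *)
Definition C1_pt c t := {for t, continuous c} /\
  forall phi, atlas S phi -> chart_dom phi (c t) -> C1_at (phi \o c) t.

Lemma C1_curve_pt c : C1_curve S c ->
  exists O : set R, [/\ open O, `[0%R, 1%R] `<=` O & forall t, O t -> C1_pt c t].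
Proof.
move=> [ O [oO sO cO H]]; exists O; split=> // t Ot; split; first exact: cO.
move=> phi ap dct; apply: (Ck_on_C1_at _ (H phi ap)); last by [].
rewrite openE => s [Os ds]; apply: filterI.
  exact: open_nbhs_nbhs.
exact: (cO s Os _ (chart_dom_nbhs ds)).
Qed.

Lemma C1_pt_curve c (O : set R) : @open R O -> `[0%R, 1%R] `<=` O ->
  (forall t, O t -> C1_pt c t) -> C1_curve S c.
Proof.
move=> oO sO H; exists O; split=> // [t /H[]//|phi ap].
by apply: C1_at_Ck_on => t [/H[_ Ht] dt]; exact: Ht.
Qed.

Lemma curve_chain_near F phi psi c t : C1_map S F -> C1_pt c t ->
  chart_dom phi (c t) ->
  \forall s \near t,
    ((psi \o F \o chart_inv phi) \o (phi \o c)) s = (psi \o (F \o c)) s.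
Proof.
move=> CF [cc Hc] dt.
have : \forall s \near t, chart_dom phi (c s) by exact: (cc _ (chart_dom_nbhs dt)).
by apply: filterS => s ds /=; rewrite chart_mapK.
Qed.

Lemma curve_chain F phi psi c t : C1_map S F -> C1_pt c t ->
  atlas S phi -> atlas S psi -> chart_dom phi (c t) -> chart_dom psi (F (c t)) ->
  'D_1 (psi \o (F \o c)) t =
  'd (psi \o F \o chart_inv phi) (phi (c t)) ('D_1 (phi \o c) t).
Proof.
move=> CF Hc ap aq dt dF.
have d1 := C1_map_diff CF ap aq dt dF.
have d2 := C1_at_diff (Hc.2 _ ap dt).
rewrite -(near_eq_derive _ (curve_chain_near psi CF Hc dt)).
exact: (@derive_comp R n _ _ (phi \o c) (psi \o F \o chart_inv phi) t 1 d2 d1).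
Qed.

Lemma C1_pt_map F c t : C1_map S F -> C1_pt c t -> C1_pt (F \o c) t.
Proof.
move=> CF Hc; split; first exact: continuous_comp Hc.1 (CF.1 _).
move=> psi aq dF; set phi := chart_at S (c t).
have ap : atlas S phi := chart_at_atlas S _.
have dt : chart_dom phi (c t) := chart_at_dom S _.
apply: C1_at_near (curve_chain_near psi CF Hc dt) _.
apply: C1_at_comp; first exact: Hc.2.
exact: (CF.2 phi psi (c t) ap aq dt dF).
Qed.

Lemma C1_curve_map F c : C1_map S F -> C1_curve S c -> C1_curve S (F \o c).
Proof.
move=> CF /C1_curve_pt[ O [oO sO H]]; apply: (C1_pt_curve oO sO) => t Ot.
by apply: C1_pt_map => //; exact: H.
Qed.

Definition speed c t : R := tangent_norm g (c t) (derive1 (chart_at S (c t) \o c) t).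

Lemma curve_lengthE c :
  curve_length g c = (\int[lebesgue_measure]_(t in `[0%R, 1%R]) (speed c t)%:E)%E.
Proof. by []. Qed.

Lemma speed_ge0 c t : 0 <= speed c t.
Proof. exact: tangent_norm_ge0. Qed.

Lemma speed_chart c phi t : C1_pt c t -> atlas S phi -> chart_dom phi (c t) ->
  speed c t = chart_norm g phi (c t) ('D_1 (phi \o c) t).
Proof.
move=> Hc ap dt; rewrite /speed derive1E.
apply: etrans (tangent_normE g _ ap dt) _.
apply: (congr1 (chart_norm g phi (c t))).
exact: esym (@curve_chain id (chart_at S (c t)) phi c t (C1_map_id S) Hc
  (chart_at_atlas S _) ap (chart_at_dom S _) dt).
Qed.

Lemma speed_map F c t A : C1_map S F -> C1_pt c t -> opbound g F (c t) A ->
  speed (F \o c) t <= A * speed c t.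
Proof.
move=> CF Hc Hb; rewrite /speed !derive1E.
rewrite (@curve_chain F (chart_at S (c t)) (chart_at S (F (c t))) c t CF Hc
  (chart_at_atlas S _) (chart_at_atlas S _) (chart_at_dom S _) (chart_at_dom S _)).
exact: Hb.
Qed.

(** The speed does not depend on the chart, so it may be computed in one chart
    for all nearby times. *)
Lemma speed_cvg c t : (\forall s \near t, C1_pt c s) ->
  speed c s @[s --> t] --> speed c t.
Proof.
move=> nH; have H := nbhs_singleton nH.
set phi := chart_at S (c t).
have ap : atlas S phi := chart_at_atlas S _.
have dt : chart_dom phi (c t) := chart_at_dom S _.
have nd : \forall s \near t, chart_dom phi (c s).
  exact: (H.1 _ (chart_dom_nbhs dt)).
have nE : \forall s \near t,
    chart_norm g phi (c s) ('D_1 (phi \o c) s) = speed c s.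
  by apply: filterS2 nH nd => s Hs ds; rewrite (speed_chart Hs ap ds).
rewrite [X in _ --> X](speed_chart H ap dt).
apply: (@cvg_near_eq _ _ _ _ _ _ _ nE).
apply: (@cvg_comp _ _ _ _ Num.sqrt _ (nbhs (bilin (metric g phi (phi (c t))) _ _))).
  apply: cvg_bilin.
  - apply: (@cvg_comp _ _ _ c (metric g phi \o phi) _ (nbhs (c t))).
      exact: H.1.
    exact: metric_cvgM.
  - exact: ((H.2 phi ap dt).2 1).
  - exact: ((H.2 phi ap dt).2 1).
exact: sqrt_continuous.
Qed.

Lemma speed_measurable c : C1_curve S c ->
  measurable_fun `[(0 : R)%R, 1%R] (speed c).
Proof.
move=> /C1_curve_pt[ O [oO sO H]]; apply: (measurable_funS _ sO).
  exact: open_measurable.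
apply: open_continuous_measurable_fun => // t; rewrite inE => Ot.
apply: speed_cvg; apply: filterS H _.
exact: open_nbhs_nbhs.
Qed.

Lemma speed_measurableE c : C1_curve S c ->
  measurable_fun `[(0 : R)%R, 1%R] (fun t => (speed c t)%:E).
Proof. by move=> Cc; apply/measurable_EFinP; exact: speed_measurable. Qed.

Lemma curve_length_ge0 c : (0 <= curve_length g c)%E.
Proof. by apply: integral_ge0 => t _; rewrite lee_fin speed_ge0. Qed.

Lemma curve_length_map F c A : C1_map S F -> C1_curve S c -> 0 <= A ->
  (forall t, 0 <= t <= 1 -> opbound g F (c t) A) ->
  (curve_length g (F \o c) <= A%:E * curve_length g c)%E.
Proof.
move=> CF Cc A0 Hb; rewrite !curve_lengthE -ge0_integralZl//; last 2 first.
- exact: speed_measurableE.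
- by move=> t _; rewrite lee_fin speed_ge0.
have [ O [oO sO H]] := C1_curve_pt Cc.
apply: ge0_le_integral => //.
- by move=> t _; rewrite lee_fin speed_ge0.
- by apply: speed_measurableE; exact: C1_curve_map.
- by apply: measurable_funeM; exact: speed_measurableE.
- move=> t t01; rewrite -EFinM lee_fin; apply: speed_map => //.
    by apply: H; exact: sO.
  by apply: Hb; move: t01; rewrite /= in_itv.
Qed.

(** By the fundamental theorem of calculus the variation of [u] up to time [t] is
    the integral of its derivative, which the speed dominates. *)
Lemma speed_lipschitz (u : M -> R) (K : R) c (O : set R) : C1_curve S c ->
  0 <= K -> @open R O -> `[0%R, 1%R] `<=` O -> (forall t, O t -> C1_at (u \o c) t) ->
  (forall t, O t -> `|'D_1 (u \o c) t| <= K * speed c t) ->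
  forall t, 0 <= t <= 1 ->
  ((`|u (c t) - u (c 0)|)%:E <= K%:E * curve_length g c)%E.
Proof.
move=> Cc K0 oO sO Hu Hb t /andP[t0 t1].
have [<-|tn0] := eqVneq 0 t.
  by rewrite subrr normr0 mule_ge0 ?curve_length_ge0.
have {tn0}t0 : 0 < t by rewrite lt_neqAle tn0.
have tO s : 0 <= s <= t -> O s.
  move=> /andP[s0 st]; apply: sO; rewrite /= in_itv/= s0/=.
  exact: le_trans t1.
have sub01 : `[0%R, t] `<=` `[0%R, 1%R].
  move=> s /=; rewrite !in_itv/= => /andP[-> st]; exact: le_trans t1.
have cD : {in O, continuous ('D_1 (u \o c))}.
  move=> s; rewrite inE => Os; exact: (Hu s Os).2.
have cD0 : {within `[0, t], continuous ('D_1 (u \o c))}.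
  apply: (@continuous_subspaceW _ _ _ O).
    by move=> s /sub01 /sO.
  exact: continuous_in_subspaceT.
have diffO s : O s -> derivable (u \o c) s 1.
  by move=> Os; apply: diff_derivable; exact/C1_at_diff/Hu.
have contO s : O s -> {for s, continuous (u \o c)}.
  by move=> Os; exact/differentiable_continuous/C1_at_diff/Hu.
have ftc := @continuous_FTC2 R ('D_1 (u \o c)) (u \o c) 0 t t0 cD0 _ _.
have {}ftc : (\int[lebesgue_measure]_(x in `[0%R, t]) ('D_1 (u \o c) x)%:E =
              (u (c t))%:E - (u (c 0%R))%:E)%E.
  apply: ftc.
    split.
    - move=> s; rewrite in_itv/= => /andP[s0 st].
      by apply: diffO; apply: tO; rewrite (ltW s0) ltW.
    - by apply/cvg_at_right_filter/contO/tO; rewrite lexx ltW.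
    - by apply/cvg_at_left_filter/contO/tO; rewrite lexx ltW.
  by move=> s _; rewrite derive1E.
have mD : measurable_fun `[(0 : R)%R, t] ('D_1 (u \o c)).
  apply: (@measurable_funS _ _ _ _ O).
  - exact: open_measurable.
  - by move=> s /sub01 /sO.
  - exact: open_continuous_measurable_fun.
rewrite -abse_EFin EFinB -ftc.
apply: le_trans (le_abse_integral _ _ _) _ => //.
  exact/measurable_EFinP.
rewrite curve_lengthE -ge0_integralZl//; last 2 first.
- exact: speed_measurableE.
- by move=> s _; rewrite lee_fin speed_ge0.
apply: le_trans (_ : (\int[lebesgue_measure]_(x in `[0%R, t])
    (K%:E * (speed c x)%:E) <= _)%E).
  apply: ge0_le_integral => //.
  - by apply: measurableT_comp => //; exact/measurable_EFinP.
  - apply: measurable_funeM; apply: (measurable_funS _ sub01) => //.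
    exact: speed_measurableE.
  - move=> s st; rewrite abse_EFin -EFinM lee_fin; apply: Hb; apply: tO.
    by move: st; rewrite /= in_itv.
apply: ge0_subset_integral => //.
  by apply: measurable_funeM; exact: speed_measurableE.
by move=> s _; rewrite mule_ge0 ?lee_fin// speed_ge0.
Qed.

End Curves.

(** * Small Riemannian balls are small neighbourhoods *)

Section Bump.
Context (R : realType).

Lemma C1_at_R (h G : R -> R) (t : R) :
  (\forall s \near t, is_derive (s : R) 1 h (G s)) -> {for t, continuous G} ->
  C1_at h t.
Proof.
move=> nD cG.
have dD : \forall s \near t, differentiable h s.
  by apply: filterS nD => s hs; apply/derivable1_diffP; exact: ex_derive.
split=> // v.
have E : \forall s \near t, v * G s = 'D_v h s.
  apply: filterS2 nD dD => s hs ds.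
  have e : 'd h s (1 : R) = G s by rewrite -deriveE// derive_val.
  rewrite deriveE// -e -[RHS](congr1 ('d h s) (mulr1 v : v *: (1 : R) = v)).
  by rewrite linearZ.
suff : 'D_v h s @[s --> t] --> 'D_v h t by [].
rewrite -(nbhs_singleton E); apply: cvg_near_eq E _.
by apply: cvgM => //; exact: cvg_cst.
Qed.

Lemma cvg_max0 (T : Type) (F : set_system T) (FF : Filter F) (w : T -> R) w0 :
  w s @[s --> F] --> w0 -> Num.max (w s) 0 @[s --> F] --> Num.max w0 0.
Proof.
move=> ww; rewrite maxr_absE.
under eq_fun do rewrite maxr_absE.
apply: cvgM; last exact: cvg_cst.
apply: cvgD; first by apply: cvgD => //; exact: cvg_cst.
by apply: cvg_norm; apply: cvgB => //; exact: cvg_cst.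
Qed.

(** The square of the positive part, which unlike the positive part itself is
    continuously differentiable at the origin. *)
Definition sqpos (w : R) := w * Num.max w 0.

Lemma is_derive_sqpos (w : R) : is_derive w 1 sqpos (2 * Num.max w 0).
Proof.
have [w0|w0|->] := ltgtP w 0.
- rewrite mulr0; apply: (@near_eq_is_derive _ _ _ (cst 0)).
    near=> z; have z0 : z < 0 by near: z; exact: lt_nbhsl.
    by rewrite /sqpos max_r ?mulr0// ltW.
- apply: (@near_eq_is_derive _ _ _ (fun z : R => z ^+ 2 : R)).
    near=> z; have z0 : 0 < z by near: z; exact: lt_nbhsr.
    by rewrite /sqpos max_l ?expr2// ltW.
  have := is_deriveX 2 (is_derive_id w (1 : R)).
  by rewrite exprfctE /= expr1 [_ *: 1]mulr1.
- rewrite mulr0.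
  have H : (fun h : R => h^-1 * (sqpos (h * 1 + 0) - sqpos 0)) @ (0 : R)^' -->
           (0 : R).
    have E : \forall h \near (0 : R)^',
        Num.max h 0 = h^-1 * (sqpos (h * 1 + 0) - sqpos 0).
      near=> h; have h0 : h != 0 by near: h; exact: nbhs_dnbhs_neq.
      by rewrite /sqpos mul0r subr0 addr0 mulr1 [RHS]mulrA mulVf// mul1r.
    have c0 : (fun h : R => Num.max h 0) @ (0 : R) --> Num.max (0 : R) 0.
      by apply: cvg_max0; exact: cvg_id.
    rewrite maxxx in c0.
    have c1 : (fun h : R => Num.max h 0) @ (0 : R)^' --> (0 : R).
      by apply: cvg_trans c0; apply: cvg_app; exact: nbhs_dnbhs.
    exact: (cvg_near_eq _ E c1).
  apply: DeriveDef; first by apply/cvg_ex; exists 0; exact: H.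
  by apply/cvg_lim => //; exact: H.
Unshelve. all: by end_near. Qed.

Context (n : nat) (a : 'rV[R]_n) (rho : R).
Implicit Types z v : 'rV[R]_n.

Definition sqdist z := \sum_i ((z ord0 i - a ord0 i) / rho) ^+ 2.

Definition bump z := sqpos (1 - sqdist z).

(** The derivative of [bump] at [z] in the direction [v]. *)
Definition dbump z v :=
  2 * Num.max (1 - sqdist z) 0 *
  - \sum_i 2 * ((z ord0 i - a ord0 i) / rho) * (v ord0 i / rho).

Lemma sqdist_ge0 z : 0 <= sqdist z.
Proof. by apply: sumr_ge0 => i _; exact: sqr_ge0. Qed.

Lemma sqdist_le1 z : 0 < rho -> sqdist z <= 1 -> `|z - a| <= rho.
Proof.
move=> r0 z1; apply: mx_norm_le; first exact: ltW.
move=> i j; rewrite !mxE ord1.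
have : ((z ord0 j - a ord0 j) / rho) ^+ 2 <= 1.
  apply: le_trans z1; rewrite /sqdist (bigD1 j)//= lerDl.
  by apply: sumr_ge0 => k _; exact: sqr_ge0.
rewrite -real_normK ?num_real// -[leRHS](expr1n _ 2) ler_sqr ?nnegrE//.
by rewrite normrM normfV (gtr0_norm r0) ler_pdivrMr// mul1r.
Qed.

Lemma bump_out z : 1 <= sqdist z -> bump z = 0.
Proof. by move=> z1; rewrite /bump /sqpos max_r ?mulr0// subr_le0. Qed.

Lemma bump_center : bump a = 1.
Proof.
rewrite /bump (_ : sqdist a = 0) ?subr0 /sqpos ?max_l ?mulr1//.
by rewrite /sqdist big1// => i _; rewrite subrr mul0r expr0n.
Qed.

Lemma dbump_out z v : 1 <= sqdist z -> dbump z v = 0.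
Proof. by move=> z1; rewrite /dbump max_r ?mulr0 ?mul0r// subr_le0. Qed.

Lemma dbump_le z v : 0 < rho -> `|dbump z v| <= 4 * n%:R / rho * `|v|.
Proof.
move=> r0; have [z1|/ltW z1] := leP (sqdist z) 1; last first.
  by rewrite dbump_out// normr0 mulr_ge0// divr_ge0// ?mulr_ge0// ltW.
have za := sqdist_le1 r0 z1.
rewrite /dbump max_l ?subr_ge0// !normrM normrN.
have w1 : `|1 - sqdist z| <= 1.
  by rewrite ger0_norm ?subr_ge0// gerBl sqdist_ge0.
have s1 : `|\sum_i 2 * ((z ord0 i - a ord0 i) / rho) * (v ord0 i / rho)|
          <= n%:R * (2 * (`|v| / rho)).
  apply: le_trans (ler_norm_sum _ _ _) _.
  apply: le_trans (_ : \sum_(i < n) 2 * (`|v| / rho) <= _); last first.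
    by rewrite sumr_const card_ord -[leLHS]mulr_natl.
  apply: ler_sum => i _; rewrite !normrM normfV (gtr0_norm r0).
  rewrite ger0_norm// -mulrA ler_wpM2l//.
  rewrite -[leRHS]mul1r; apply: ler_pM => //.
  - by rewrite divr_ge0// ltW.
  - by rewrite divr_ge0// ltW.
  - rewrite ler_pdivrMr// mul1r; apply: le_trans za.
    by have := mx_entry_le (z - a) ord0 i; rewrite !mxE.
  - by rewrite ler_pM2r ?invr_gt0//; exact: mx_entry_le.
apply: le_trans (_ : 2 * 1 * (n%:R * (2 * (`|v| / rho))) <= _).
  by rewrite ger0_norm//; apply: ler_pM => //; rewrite ?mulr_ge0// ler_pM2l.
by rewrite le_eqVlt; apply/orP; left; apply/eqP; ring.
Qed.

Lemma cvg_sqdist (T : Type) (F : set_system T) (FF : Filter F)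
    (y : T -> 'rV[R]_n) z : y s @[s --> F] --> z ->
  sqdist (y s) @[s --> F] --> sqdist z.
Proof.
move=> yz; apply: cvg_sumr => i.
under eq_fun do rewrite expr2.
have H : (y s ord0 i - a ord0 i) / rho @[s --> F] --> (z ord0 i - a ord0 i) / rho.
  apply: cvgM; last exact: cvg_cst.
  by apply: cvgB; [exact: cvg_entry|exact: cvg_cst].
by rewrite expr2; apply: cvgM.
Qed.

Lemma cvg_bump (T : Type) (F : set_system T) (FF : Filter F)
    (y : T -> 'rV[R]_n) z : y s @[s --> F] --> z ->
  bump (y s) @[s --> F] --> bump z.
Proof.
move=> yz.
have H : 1 - sqdist (y s) @[s --> F] --> 1 - sqdist z.
  by apply: cvgB; [exact: cvg_cst|exact: cvg_sqdist].
by apply: cvgM => //; exact: cvg_max0.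
Qed.

Lemma cvg_dbump (T : Type) (F : set_system T) (FF : Filter F)
    (y y' : T -> 'rV[R]_n) z v : y s @[s --> F] --> z -> y' s @[s --> F] --> v ->
  dbump (y s) (y' s) @[s --> F] --> dbump z v.
Proof.
move=> yz yv; apply: cvgM.
  apply: cvgM; first exact: cvg_cst.
  by apply: cvg_max0; apply: cvgB; [exact: cvg_cst|exact: cvg_sqdist].
apply: cvgN; apply: cvg_sumr => i; apply: cvgM.
  apply: cvgM; first exact: cvg_cst.
  apply: cvgM; last exact: cvg_cst.
  by apply: cvgB; [exact: cvg_entry|exact: cvg_cst].
by apply: cvgM; [exact: cvg_entry|exact: cvg_cst].
Qed.

Lemma is_derive_bump (y : R -> 'rV[R]_n) (t : R) : derivable y t 1 ->
  is_derive t 1 (bump \o y) (dbump (y t) ('D_1 y t)).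
Proof.
move=> dy.
have di i : is_derive t 1 (fun s => y s ord0 i) ('D_1 y t ord0 i).
  apply: DeriveDef; first by move/derivable_mxP : dy.
  by rewrite derive_mx// mxE.
have dq i : is_derive t 1 (fun s => ((y s ord0 i - a ord0 i) / rho) ^+ 2)
    (2 * ((y t ord0 i - a ord0 i) / rho) * ('D_1 y t ord0 i / rho)).
  have d1 : is_derive t 1 (fun s => (y s ord0 i - a ord0 i) / rho)
                         ('D_1 y t ord0 i / rho).
    have d2 := is_deriveB (di i) (is_derive_cst (a ord0 i) t 1).
    have := is_deriveM d2 (is_derive_cst rho^-1 t (1 : R)).
    by rewrite scaler0 add0r subr0 [_ *: _]mulrC.
  have := is_deriveX 2 d1; rewrite exprfctE /= expr1; exact.
have dw : is_derive t 1 (fun s => 1 - sqdist (y s))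
   (- \sum_i 2 * ((y t ord0 i - a ord0 i) / rho) * ('D_1 y t ord0 i / rho)).
  have ds := is_derive_sum dq.
  have := is_deriveB (is_derive_cst (1 : R) t 1) ds.
  rewrite sub0r (_ : cst 1 - _ = fun s => 1 - sqdist (y s))//.
  by apply/funext => s; rewrite /sqdist !fctE fct_sumE.
exact: (@is_derive1_comp R sqpos _ t _ _ (is_derive_sqpos _) dw).
Qed.

End Bump.

Section Tube.
Context (R : realType) (n : nat) (M : topologicalType).
Context (S : smooth_manifold R n M) (g : riemannian_metric S).
Implicit Types (F : M -> M) (phi psi : chart R n M) (c : R -> M).

(** Lipschitz along curves: the bound holds at every time of the curve, not only
    at its end, since paths have to be confined at all times. *)
Definition curve_lipschitz (K : R) (u : M -> R) :=
  forall c, C1_curve S c -> forall t : R, 0 <= t <= 1 ->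
  ((`|u (c t) - u (c 0)|)%:E <= K%:E * curve_length g c)%E.

Lemma path_length_ge0 x y l : piecewise_C1_length g x y l -> (0 <= l)%E.
Proof.
by elim=> [//|c l' _ l0 _]; rewrite adde_ge0// curve_length_ge0.
Qed.

Lemma path_lipschitz K u x y l : 0 <= K -> curve_lipschitz K u ->
  piecewise_C1_length g x y l -> ((`|u y - u x|)%:E <= K%:E * l)%E.
Proof.
move=> K0 Hu; elim=> [|c l' Hl IH Cc]; first by rewrite subrr normr0 mule0.
rewrite ge0_muleDr ?(path_length_ge0 Hl) ?curve_length_ge0//.
apply: le_trans (_ : (`|u (c 0%R) - u x|%:E + `|u (c 1%R) - u (c 0%R)|%:E <= _)%E).
  by rewrite -EFinD lee_fin [leRHS]addrC; exact: ler_distD.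
by apply: leeD => //; apply: Hu => //; rewrite ler01 lexx.
Qed.

Lemma C1_at_near_cst (h : R -> R) (t : R) :
  (\forall s \near t, h s = 0) -> C1_at h t /\ 'D_1 h t = 0.
Proof.
move=> h0.
have h0' : \forall s \near t, cst 0 s = h s by apply: filterS h0 => s ->.
split; last by rewrite -(near_eq_derive (1 : R) h0') derive_cst.
apply: (@C1_at_R R h (cst 0)); last exact: cst_continuous.
by apply: filterS (near_join h0') => s hs; exact: near_eq_is_derive hs _.
Qed.

(** A chart bump function extended by zero; its support is compact, hence closed
    in the manifold, which is what makes it regular across the boundary of the
    chart domain. *)
Lemma bump_function x (W : set M) : nbhs x W ->
  exists u K, [/\ 0 < K, curve_lipschitz K u, u x = 1,
    {for x, continuous u} & forall y, ~ W y -> u y = 0].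
Proof.
move=> nW; set phi := chart_at S x.
have ap : atlas S phi := chart_at_atlas S x.
have dx : chart_dom phi x := chart_at_dom S x.
have [m m0 mP] := posdef_near _ (metric_cvg (g := g) ap dx)
  (fun u u0 => metric_gt0 g ap dx u0).
have [e e0 eP] : exists2 e : R, 0 < e & forall z, `|phi x - z| < e ->
    [/\ chart_ran phi z, W (chart_inv phi z) &
        forall v, m * `|v| ^+ 2 <= bilin (metric g phi z) v v].
  have H1 := chart_ran_nbhs dx.
  have H2 : \forall z \near phi x, W (chart_inv phi z) by exact: chart_inv_cvg.
  case: (iffLR (nbhs_ballP (phi x) _) (filterI H1 (filterI H2 mP))) => e e0 eP.
  by exists e => // z ze; have [|? []] := eP z; rewrite -?ball_normE.
pose rho := e / 2; have r0 : 0 < rho by rewrite divr_gt0.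
have re : rho < e by rewrite ltr_pdivrMr// ltr_pMr// ltr1n.
pose q := sqdist (phi x) rho.
have qP z : q z <= 1 -> [/\ chart_ran phi z, W (chart_inv phi z) &
    forall v, m * `|v| ^+ 2 <= bilin (metric g phi z) v v].
  move=> qz; apply: eP; rewrite distrC; apply: le_lt_trans re.
  exact: sqdist_le1.
pose D := [set z | q z <= 1].
have cD : compact D.
  apply: bounded_closed_compact.
    exists (`|phi x| + rho); split; first exact: num_real.
    move=> k kr z /(sqdist_le1 r0) zr; apply: le_trans (ltW kr).
    by rewrite -(subrK (phi x) z) addrC (le_trans (ler_normD _ _))// lerD2l.
  rewrite (_ : D = q @^-1` [set r | r <= 1]) //.
  apply: closed_comp; last exact: closed_le.
  move=> z _.
  exact: (@cvg_sqdist R n (phi x) rho _ (nbhs z) _ id z cvg_id).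
pose A := chart_inv phi @` D.
have cA : closed A.
  apply: compact_closed; first exact: hausdorff_manifold S.
  apply: continuous_compact => //.
  apply: continuous_in_subspaceT => z; rewrite inE => /qP[rz _ _].
  exact: chart_inv_continuous.
have [u uE] : exists u : M -> R, forall y,
    u y = if pselect (chart_dom phi y) then bump (phi x) rho (phi y) else 0.
  by exists (fun y => if pselect (chart_dom phi y)
               then bump (phi x) rho (phi y) else 0).
have uin y : chart_dom phi y -> u y = bump (phi x) rho (phi y).
  by move=> dy; rewrite uE; case: pselect.
have uout y : ~ A y -> u y = 0.
  move=> Ay; rewrite uE; case: pselect => // dy; apply: bump_out.
  rewrite leNgt; apply/negP => /ltW qy; apply: Ay.
  by exists (phi y) => //; rewrite chart_mapK.
pose K := 4 * n%:R / rho / Num.sqrt m + 1.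
have K0' : 0 <= 4 * n%:R / rho / Num.sqrt m.
  by rewrite !divr_ge0// ?mulr_ge0// ltW.
have K0 : 0 < K by rewrite ltr_wpDl.
exists u, K; split => //.
- move=> c Cc t t01; have [ Om [oO sO H]] := C1_curve_pt Cc.
  have HD s : Om s -> C1_at (u \o c) s /\ `|'D_1 (u \o c) s| <= K * speed g c s.
    move=> Os; have Hs := H s Os.
    (* Outside the chart domain the curve avoids the closed support for a while,
       so the function vanishes along it. *)
    have [ds|nds] := pselect (chart_dom phi (c s)); last first.
      have nA : \forall r \near s, (~` A) (c r).
        apply: (Hs.1 (~` A)); apply: open_nbhs_nbhs; split.
          exact: closed_openC.
        by move=> [z /qP[rz _ _] cz]; apply: nds; rewrite -cz; exact: chart_inv_dom.
      have [regu du0] := C1_at_near_cst (filterS (fun r => @uout (c r)) nA).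
      split; first exact: regu.
      by rewrite du0 normr0 mulr_ge0 ?speed_ge0// ltW.
    have nO : \forall r \near s, Om r by exact: open_nbhs_nbhs.
    have nd : \forall r \near s, chart_dom phi (c r).
      exact: (Hs.1 _ (chart_dom_nbhs ds)).
    have uEn : \forall r \near s, (bump (phi x) rho \o (phi \o c)) r = (u \o c) r.
      by apply: filterS nd => r dr; rewrite /= uin.
    pose G r := dbump (phi x) rho ((phi \o c) r) ('D_1 (phi \o c) r).
    have dG : \forall r \near s, is_derive (r : R) 1 (u \o c) (G r).
      apply: filterS3 nO nd (near_join uEn) => r Or dr ur.
      apply: near_eq_is_derive ur _; apply: is_derive_bump.
      by apply: diff_derivable; apply: C1_at_diff; exact: (H r Or).2.
    have cG : {for s, continuous G}.
      apply: cvg_dbump; last exact: ((Hs.2 phi ap ds).2 1).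
      exact/differentiable_continuous/C1_at_diff/(Hs.2 phi ap ds).
    split; first exact: C1_at_R dG cG.
    have dGs := nbhs_singleton dG; rewrite derive_val.
    have [qs|/ltW qs] := leP (q (phi (c s))) 1; last first.
      by rewrite /G dbump_out// normr0 mulr_ge0 ?speed_ge0// ltW.
    apply: (le_trans (dbump_le _ _ _ r0)).
    apply: le_trans (_ : 4 * n%:R / rho / Num.sqrt m * speed g c s <= _); last first.
      by rewrite ler_wpM2r ?speed_ge0// lerDl.
    rewrite -[leRHS]mulrA; apply: ler_wpM2l; first by rewrite divr_ge0// ltW.
    rewrite mulrC ler_pdivlMr ?sqrtr_gt0//.
    rewrite (speed_chart g Hs ap ds); have [_ _ mv] := qP _ qs.
    apply: le_trans (ler_wsqrtr (mv ('D_1 (phi \o c) s))).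
    by rewrite mulrC sqrtrM ?(ltW m0)// sqrtr_sqr normr_id.
  apply: (@speed_lipschitz _ _ _ _ g u K c Om) => //; first exact: ltW.
    by move=> s /HD[].
  by move=> s /HD[].
- by rewrite uin// bump_center.
- have nd := chart_dom_nbhs dx.
  suff : u y @[y --> x] --> u x by [].
  rewrite (uin _ dx).
  apply: (@cvg_near_eq _ _ _ _ (fun y => bump (phi x) rho (phi y))).
    by apply: filterS nd => y dy; rewrite uin.
  by apply: cvg_bump; exact: chart_map_continuous.
- move=> y Wy; apply: uout => -[z /qP[_ Wz _] zy]; apply: Wy.
  by rewrite -zy.
Qed.

(** A bump function close to 1 at the start and vanishing outside the
    neighbourhood cannot drop to 0 along a path shorter than its Lipschitz
    constant allows; compactness makes the admissible length uniform. *)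
Lemma tube (L W : set M) : compact L -> open W -> L `<=` W ->
  exists2 delta : R, 0 < delta & forall x z l c t, L x ->
    piecewise_C1_length g x z l -> C1_curve S c -> c 0 = z ->
    (l + curve_length g c < delta%:E)%E -> 0 <= t <= 1 -> W (c t).
Proof.
move=> /compact_near_coveringP cL oW sW.
pose P (d : R) x := forall z l c t,
    piecewise_C1_length g x z l -> C1_curve S c -> c 0 = z ->
    (l + curve_length g c < d%:E)%E -> 0 <= t <= 1 -> W (c t).
have : \forall d \near (0 : R)^'+, L `<=` P d.
  apply: cL => x Lx.
  have nW : nbhs x W by apply: open_nbhs_nbhs; split => //; exact: sW.
  have [u [K [K0 uK ux uc uW]]] := bump_function nW.
  have nu : \forall x' \near x, 1 / 2 < u x'.
    by apply: (cvgr_gt _ uc); rewrite ux ltr_pdivrMr// mul1r ltr1n.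
  have nd : \forall d \near (0 : R)^'+, d < 1 / 2 / K.
    by apply: nbhs_right_lt; rewrite !divr_gt0.
  exists ([set x' | 1 / 2 < u x'], [set d | d < 1 / 2 / K]) => //.
  move=> [x' d] /= [ux' dK] z l c t Hl Cc cz ld t01.
  apply: contrapT => nWt; have ut := uW _ nWt.
  have : ((`|u (c t) - u x'|)%:E < (1 / 2)%:E)%E.
    apply: (@le_lt_trans _ _ (K%:E * (l + curve_length g c))%E); last first.
      apply: (@le_lt_trans _ _ (K%:E * d%:E)%E).
        by rewrite lee_pmul2l// ?ltW// lte_fin.
      by rewrite -EFinM lte_fin mulrC -ltr_pdivlMr.
    rewrite ge0_muleDr ?(path_length_ge0 Hl) ?curve_length_ge0//.
    apply: le_trans (_ : (`|u z - u x'|%:E + `|u (c t) - u z|%:E <= _)%E).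
      by rewrite -EFinD lee_fin [leRHS]addrC; exact: ler_distD.
    apply: leeD; first exact: (path_lipschitz (ltW K0) uK Hl).
    by rewrite -cz; exact: uK.
  rewrite ut sub0r normrN lte_fin => H.
  by have := lt_trans (lt_le_trans ux' (ler_norm _)) H; rewrite ltxx.
move=> nP; near (0 : R)^'+ => d.
exists d; first by near: d; exact: nbhs_right_gt.
move=> x z l c t Lx; have : L `<=` P d by near: d.
by move=> /(_ x Lx); apply.
Unshelve. all: by end_near. Qed.

(** Short paths from a point of the compact set [L] remain where the differential
    of [F] has norm at most [A], so that [F] maps them to paths at most [A] times
    as long. *)
Lemma dist_expansion (L : set M) F (A : R) : compact L -> C1_map S F -> 0 < A ->
  (forall x, L x -> tangent_map_norm g F x < A) ->
  exists2 delta : R, 0 < delta & forall x y r, L x -> r <= delta ->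
    (riemannian_dist g x y < r%:E)%E ->
    (riemannian_dist g (F x) (F y) < (A * r)%:E)%E.
Proof.
move=> cL CF A0 HA.
pose W := interior [set y | opbound g F y A].
have LW : L `<=` W by move=> x /HA; exact: opbound_near.
have [d d0 dP] := tube cL (open_interior _ : open W) LW.
exists d => // x y r Lx rd /ereal_inf_lt[l Hl lr].
have ld : (l < d%:E)%E by apply: lt_le_trans lr _; rewrite lee_fin.
have [l' Hl' l'le] : exists2 l', piecewise_C1_length g (F x) (F y) l' &
    (l' <= A%:E * l)%E.
  move: ld; elim: Hl => [_|c k Hk IH Cc ld].
    by exists 0%E; [exact: piecewise_C1_nil|rewrite mule0].
  have kd : (k < d%:E)%E.
    by apply: le_lt_trans ld; rewrite leeDl// curve_length_ge0.
  have [k' Hk' k'le] := IH kd.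
  exists (k' + curve_length g (F \o c))%E.
    by apply: (@piecewise_C1_snoc _ _ _ _ g (F x) (F \o c) k' Hk'); exact: C1_curve_map.
  rewrite ge0_muleDr ?(path_length_ge0 Hk) ?curve_length_ge0//.
  apply: leeD => //; apply: curve_length_map => //; first exact: ltW.
  move=> t t01; have /interior_subset := dP _ _ _ c t Lx Hk Cc erefl ld t01.
  exact.
apply: (@le_lt_trans _ _ l').
  by apply: ereal_inf_lbound.
by apply: (le_lt_trans l'le); rewrite EFinM lte_pmul2l.
Qed.

(** The end point of a path is one of its points, so [tube] confines it too. *)
Lemma dist_nbhd (L W : set M) : compact L -> open W -> L `<=` W ->
  exists2 delta : R, 0 < delta & forall x y, L x ->
    (riemannian_dist g x y < delta%:E)%E -> W y.
Proof.
move=> cL oW LW; have [d d0 dP] := tube cL oW LW.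
exists d => // x y Lx /ereal_inf_lt[l Hl ld].
case: Hl ld => [_|c k Hk Cc kd]; first exact: LW.
by apply: (dP _ _ _ c 1 Lx Hk Cc erefl kd); rewrite ler01 lexx.
Qed.

End Tube.

(** * Coordinate segments and coordinate cubes *)

Section Integrals.
Context (R : realType).

(** The inner integrals of an iterated integral are not known to be measurable
    functions; monotonicity still holds because the integral of a nonnegative
    function is a supremum over the simple functions below it. *)
Lemma ge0_le_integralT (f h : R -> \bar R) :
  (forall t, 0 <= f t)%E -> (forall t, f t <= h t)%E ->
  (\int[lebesgue_measure]_t f t <= \int[lebesgue_measure]_t h t)%E.
Proof.
move=> f0 fh; have h0 t : (0 <= h t)%E by apply: le_trans (fh t).
have -> := ge0_integralTE (@lebesgue_measure R) f0.
have -> := ge0_integralTE (@lebesgue_measure R) h0.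
apply: ereal_sup_le => _ [s /= sf <-].
by exists s => //= x; apply: le_trans (sf x) _.
Qed.

Lemma iterated_integral_ge0 m (F : 'rV[R]_m -> \bar R) :
  (forall y, 0 <= F y)%E -> (0 <= iterated_integral F)%E.
Proof.
elim: m F => [|m IH] F F0 /=; first exact: F0.
by apply: integral_ge0 => t _; apply: IH => y; exact: F0.
Qed.

Lemma iterated_integral_le m (F G : 'rV[R]_m -> \bar R) :
  (forall y, 0 <= F y)%E -> (forall y, F y <= G y)%E ->
  (iterated_integral F <= iterated_integral G)%E.
Proof.
elim: m F G => [|m IH] F G F0 FG /=; first exact: FG.
apply: ge0_le_integralT => t; first by apply: iterated_integral_ge0 => y.
by apply: IH => y.
Qed.

Definition in_cube m (a : 'rV[R]_m) (r : R) (y : 'rV[R]_m) : bool :=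
  [forall i, `|a ord0 i - y ord0 i| < r].

Lemma in_cubeP m (a y : 'rV[R]_m) r : 0 < r -> (`|a - y| < r) = in_cube a r y.
Proof.
move=> r0; apply/idP/forallP => [ay i|H].
  by apply: le_lt_trans ay; have := mx_entry_le (a - y) ord0 i; rewrite !mxE.
by apply: mx_norm_lt => // i j; rewrite !mxE ord1.
Qed.

Lemma integral_cst_ball (a r c : R) : 0 < r ->
  (\int[lebesgue_measure]_t (if (`|a - t| < r)%R then c%:E else 0))%E =
  (c * (2 * r))%:E.
Proof.
move=> r0; pose A : set R := `]a - r, a + r[%classic.
transitivity (\int[lebesgue_measure]_(t in A) (cst c%:E t))%E.
  rewrite [RHS]integral_mkcond; apply: eq_integral => t _.
  rewrite patchE (_ : (t \in A) = (`|a - t| < r)) //.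
  rewrite distrC ltr_distl; apply/idP/idP; rewrite inE /A /= in_itv/=.
    by move=> ->.
  by move=> /andP[-> ->].
rewrite integral_cst; last exact: measurable_itv.
have mA : lebesgue_measure A = (2 * r)%:E.
  rewrite lebesgue_measure_itv/= lte_fin ifT; last by lra.
  by rewrite -EFinB; congr (_%:E); lra.
by apply: etrans (congr1 (mule c%:E) mA) _; rewrite -EFinM.
Qed.

Lemma iterated_integral_cube m (a : 'rV[R]_m) (r c : R) : 0 < r ->
  iterated_integral (fun y => if in_cube a r y then c%:E else 0%E) =
  (c * (2 * r) ^+ m)%:E.
Proof.
move=> r0; elim: m a => [|m IH] a /=.
  by rewrite ifT ?mulr1//; apply/forallP => -[].
pose a' : 'rV[R]_m := \row_j a ord0 (lift ord0 j).
have E t (y : 'rV[R]_m) : in_cube a r (row_mx (const_mx t : 'rV[R]_1) y) =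
    (`|a ord0 ord0 - t| < r) && in_cube a' r y.
  have e0 : row_mx (const_mx t : 'rV[R]_1) y ord0 (ord0 : 'I_(1 + m)) = t.
    by rewrite (_ : ord0 = lshift m (ord0 : 'I_1)) ?row_mxEl ?mxE//; exact/val_inj.
  have e1 j : row_mx (const_mx t : 'rV[R]_1) y ord0 (lift (ord0 : 'I_(1 + m)) j) = y ord0 j.
    by rewrite (_ : lift _ j = rshift 1 j) ?row_mxEr//; exact/val_inj.
  apply/forallP/andP => [H|[H0 /forallP H] i].
    split; first by have := H ord0; rewrite e0.
    by apply/forallP => j; have := H (lift ord0 j); rewrite e1 mxE.
  have [j ->|->] := unliftP ord0 i; last by rewrite e0.
  by have := H j; rewrite e1 mxE.
have I0 : iterated_integral (fun y : 'rV[R]_m => 0%E) = 0%E.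
  elim: (m) => [//|k IHk] /=.
  by under eq_fun do rewrite IHk; rewrite integral0.
transitivity (\int[lebesgue_measure]_t
   (if (`|a ord0 ord0 - t| < r)%R then (c * (2 * r) ^+ m)%:E else 0))%E.
  apply: eq_integral => t _; rewrite -(IH a').
  case: ifP => tr.
    by congr iterated_integral; apply/funext => y; rewrite E tr.
  by rewrite -I0; congr iterated_integral; apply/funext => y; rewrite E tr.
by rewrite integral_cst_ball// -mulrA -exprSr.
Qed.

End Integrals.

Section Cubes.
Context (R : realType) (n : nat) (M : topologicalType).
Context (S : smooth_manifold R n M) (g : riemannian_metric S).
Implicit Types (F : M -> M) (phi psi : chart R n M) (c : R -> M).

(** The straight segment in the chart is a curve whose speed is controlled by the
    upper bound on the metric. *)
Lemma dist_chart_segment phi (a0 : 'rV[R]_n) (e K : R) (a b : 'rV[R]_n) :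
  atlas S phi -> 0 <= K ->
  (forall z, `|a0 - z| < e -> chart_ran phi z /\
     forall v, bilin (metric g phi z) v v <= K ^+ 2 * `|v| ^+ 2) ->
  `|a0 - a| < e -> `|a0 - b| < e ->
  (riemannian_dist g (chart_inv phi a) (chart_inv phi b) <=
   (K * `|b - a|)%:E)%E.
Proof.
move=> ap K0 HB ae be.
pose l (t : R) := a + t *: (b - a).
pose c t := chart_inv phi (l t).
have Cl t : C1_at l t by exact: C1_at_affine.
have cl : continuous l.
  by move=> t; exact: (differentiable_continuous (C1_at_diff (Cl t))).
pose Om : set R := l @^-1` [set z | `|a0 - z| < e].
have oO : open Om.
  apply: open_comp; first by move=> t _; exact: cl.
  rewrite (_ : [set z | _] = (fun z : 'rV[R]_n => `|a0 - z|) @^-1` [set r | r < e])//.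
  apply: open_comp; last exact: open_lt.
  move=> z _; exact: (@cvg_dist R _ (nbhs z) _ n id a0 z cvg_id).
have sO : `[0%R, 1%R] `<=` Om.
  move=> t /=; rewrite in_itv/= => /andP[t0 t1]; rewrite /Om /=.
  have -> : a0 - l t = (1 - t) *: (a0 - a) + t *: (a0 - b).
    by rewrite /l; apply/rowP => i; rewrite !mxE; ring.
  apply: (le_lt_trans (ler_normD _ _)); rewrite !normrZ !ger0_norm ?subr_ge0//.
  move: t0; rewrite le_eqVlt => /orP[/eqP <-|t0].
    by rewrite subr0 mul1r mul0r addr0.
  rewrite -[ltRHS]mul1r -[X in _ < X * _](subrK t 1) [ltRHS]mulrDl.
  by apply: ler_ltD; [rewrite ler_wpM2l ?subr_ge0// ltW|rewrite ltr_pM2l].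
have HO t : Om t -> C1_pt S c t.
  move=> Ot; have [rt _] := HB _ Ot; split.
    apply: (@continuous_comp _ _ _ l (chart_inv phi)); first exact: cl.
    exact: chart_inv_continuous.
  move=> psi aq dt; apply: (@C1_at_comp R n _ _ l (psi \o chart_inv phi)).
    exact: Cl.
  have := (C1_map_id S).2 phi psi (c t) ap aq (chart_inv_dom rt) dt.
  by rewrite /c chart_invK.
have Cc : C1_curve S c by exact: (C1_pt_curve oO sO HO).
have Hsp t : Om t -> speed g c t <= K * `|b - a|.
  move=> Ot; have [rt mt] := HB _ Ot.
  have nO : \forall s \near t, Om s by exact: open_nbhs_nbhs.
  have nl : \forall s \near t, l s = (phi \o c) s.
    by apply: filterS nO => s /HB[rs _]; rewrite /= chart_invK.
  rewrite (speed_chart g (HO t Ot) ap (chart_inv_dom rt)).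
  rewrite -(near_eq_derive _ nl) derive_affine scale1r /chart_norm /c chart_invK//.
  apply: le_trans (ler_wsqrtr (mt _)) _.
  by rewrite -exprMn sqrtr_sqr ger0_norm// mulr_ge0.
apply: (@le_trans _ _ (0 + curve_length g c)%E).
  apply: ereal_inf_lbound.
  have e0 : chart_inv phi a = c 0 by rewrite /c /l scale0r addr0.
  have e1 : chart_inv phi b = c 1 by rewrite /c /l scale1r addrC subrK.
  rewrite e0 e1; apply: piecewise_C1_snoc => //.
  exact: piecewise_C1_nil.
rewrite add0e curve_lengthE.
apply: (@le_trans _ _ (\int[lebesgue_measure]_(t in `[(0 : R)%R, 1%R])
   cst (K * `|b - a|)%:E t)%E).
  apply: ge0_le_integral => //.
  - by move=> t _; rewrite lee_fin speed_ge0.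
  - exact: speed_measurableE.
  - by move=> t t01; rewrite lee_fin; apply: Hsp; exact: sO.
rewrite integral_cst//.
have m1 : lebesgue_measure (`[(0 : R)%R, 1%R]%classic : set R) = 1%E.
  by rewrite lebesgue_measure_itv/= lte_fin ltr01 sube0.
rewrite le_eqVlt; apply/orP; left; apply/eqP.
by apply: etrans (congr1 (mule _) m1) _; rewrite mule1.
Qed.

Definition chart_cube phi (a : 'rV[R]_n) (r : R) : set M :=
  [set y | chart_dom phi y /\ `|a - phi y| < r].

Lemma chart_cube_open phi a r : open (chart_cube phi a r).
Proof.
rewrite openE => y [dy ay].
have n1 := chart_dom_nbhs dy.
have n2 : \forall z \near y, `|a - phi z| < r.
  have cv : `|a - phi z| @[z --> y] --> `|a - phi y|.
    by apply: (@cvg_dist R _ (nbhs y) _ n phi); exact: chart_map_continuous.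
  exact: (cvgr_lt _ cv).
by apply: filterS2 n1 n2 => z.
Qed.

Lemma chart_volume_cube phi a r (kappa : R) : atlas S phi -> 0 < r ->
  0 <= kappa ->
  (forall z, `|a - z| < r -> chart_ran phi z /\
     kappa <= Num.sqrt (\det (metric g phi z))) ->
  ((kappa * (2 * r) ^+ n)%:E <= chart_volume g phi (chart_cube phi a r))%E.
Proof.
move=> ap r0 k0 H; rewrite -(iterated_integral_cube a kappa r0).
apply: iterated_integral_le => y.
  by case: ifP; rewrite lee_fin.
case: ifP => [|_]; last by case: ifP; rewrite lee_fin// sqrtr_ge0.
rewrite -in_cubeP// => ay; have [ry ky] := H _ ay.
rewrite ifT ?lee_fin//; apply/mem_set; exists (chart_inv phi y).
  by split; [exact: chart_inv_dom|rewrite chart_invK].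
exact: chart_invK.
Qed.

(** Both orders of the arguments of the distance are recorded, so that a path from
    the centre of one cell to that of another through a common point arises by
    concatenation, without reversing a curve. *)
Definition small_cell (x : M) (kappa r : R) := exists phi (B : set M),
  [/\ atlas S phi, open B, B `<=` chart_dom phi,
      forall z, B z -> (riemannian_dist g x z < r%:E)%E /\
                       (riemannian_dist g z x < r%:E)%E &
      ((kappa * r ^+ n)%:E <= chart_volume g phi B)%E].

(** Near each point the metric is comparable to the Euclidean metric of a chart,
    so that coordinate cubes serve as small balls; compactness then gives one
    constant for the whole set. *)
Lemma small_cells (L : set M) : compact L ->
  exists2 kappa : R, 0 < kappa &
    \forall r \near (0 : R)^'+, forall x, L x -> small_cell x kappa r.
Proof.
move=> /compact_near_coveringP cL.
pose P (kr : R * R) x := small_cell x kr.1 kr.2.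
have : \forall kr \near filter_prod (0 : R)^'+ (0 : R)^'+, L `<=` P kr.
  apply: cL => x Lx; set phi := chart_at S x.
  have ap : atlas S phi := chart_at_atlas S x.
  have dx : chart_dom phi x := chart_at_dom S x.
  have [K K0 KP] := bilin_near_le _ (metric_cvg (g := g) ap dx).
  have d0 : 0 < \det (metric g phi (phi x)).
    by apply: posdef_det_gt0 => u; exact: metric_gt0.
  have nd : \forall z \near phi x,
      \det (metric g phi (phi x)) / 2 < \det (metric g phi z).
    have cv : \det (metric g phi z) @[z --> phi x] --> \det (metric g phi (phi x)).
      exact: (cvg_det _ (metric_cvg (g := g) ap dx)).
    by apply: (cvgr_gt _ cv); rewrite ltr_pdivrMr// ltr_pMr// ltr1n.
  set dt := _ / 2 in nd; have dt0 : 0 < dt by rewrite divr_gt0.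
  pose k1 := Num.sqrt dt; have k10 : 0 < k1 by rewrite sqrtr_gt0.
  have [e e0 eP] : exists2 e : R, 0 < e & forall z, `|phi x - z| < e ->
    [/\ chart_ran phi z, forall v, bilin (metric g phi z) v v <= K * `|v| ^+ 2 &
        dt < \det (metric g phi z)].
    have H1 := chart_ran_nbhs dx.
    case: (iffLR (nbhs_ballP (phi x) _) (filterI H1 (filterI KP nd))) => e e0 eP.
    by exists e => // z ze; have [|? []] := eP z; rewrite -?ball_normE.
  (* A constant at least 1 dominating the square root of [K]; cells of radius
     [r / (s + s)] leave a strict inequality in the distance estimate. *)
  pose s := Num.sqrt K + 1; have s0 : 0 < s by rewrite ltr_wpDl// sqrtr_ge0.
  have Ks : K <= s ^+ 2.
    rewrite -[leLHS]sqr_sqrtr ?(ltW K0)// ler_sqr ?nnegrE ?sqrtr_ge0 ?(ltW s0)//.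
    by rewrite lerDl.
  have nx : \forall x' \near x, chart_dom phi x' /\ `|phi x - phi x'| < e / 2.
    have := @chart_cube_open phi (phi x) (e / 2).
    rewrite openE => /(_ x); apply; split => //.
    by rewrite subrr normr0 divr_gt0.
  have nr : \forall kr \near filter_prod (0 : R)^'+ (0 : R)^'+,
      [/\ kr.1 < k1 * (2 / (s + s)) ^+ n, 0 < kr.2 & kr.2 < e / 2].
    exists ([set k | k < k1 * (2 / (s + s)) ^+ n],
            [set r | 0 < r /\ r < e / 2]) => /=.
      split; first by apply: nbhs_right_lt; rewrite mulr_gt0// exprn_gt0// divr_gt0// addr_gt0.
      apply: filterI; first exact: nbhs_right_gt.
      by apply: nbhs_right_lt; rewrite divr_gt0.
    by move=> [k r] /= [? []].
  exists ([set x' | chart_dom phi x' /\ `|phi x - phi x'| < e / 2],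
          [set kr | [/\ kr.1 < k1 * (2 / (s + s)) ^+ n, 0 < kr.2 & kr.2 < e / 2]]) => //.
  move=> [x' [k r]] /= [[dx' xx'] [kk r0 re]].
  have s1 : 1 <= s by rewrite lerDr sqrtr_ge0.
  have ss0 : 0 < s + s by rewrite addr_gt0.
  pose rho := r / (s + s).
  have rho0 : 0 < rho by rewrite divr_gt0.
  have rhoe : rho < e / 2.
    apply: le_lt_trans re; rewrite (ler_pdivrMr _ _ ss0).
    by apply: ler_peMr; [exact: ltW|lra].
  have cube_e z : `|phi x' - z| < rho -> `|phi x - z| < e.
    move=> zr; rewrite -(subrKA (phi x')).
    apply: (le_lt_trans (ler_normD _ _)); rewrite (splitr e) ltrD//.
    exact: lt_trans zr rhoe.
  exists phi, (chart_cube phi (phi x') rho); split => //.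
  - exact: chart_cube_open.
  - by move=> z [].
  - move=> z [dz zr].
    have HB y : `|phi x - y| < e -> chart_ran phi y /\
        forall v, bilin (metric g phi y) v v <= s ^+ 2 * `|v| ^+ 2.
      move=> /eP[ry by_ _]; split => // v; apply: (le_trans (by_ v)).
      by rewrite ler_wpM2r// exprn_ge0.
    have x'e : `|phi x - phi x'| < e by apply: lt_trans xx' _; lra.
    have ze := cube_e _ zr.
    have sr : s * rho < r.
      by rewrite /rho mulrA (ltr_pdivrMr _ _ ss0) mulrC ltr_pM2l//; lra.
    have := dist_chart_segment ap (ltW s0) HB x'e ze.
    have := dist_chart_segment ap (ltW s0) HB ze x'e.
    rewrite !chart_mapK// => h1 h2; split.
      apply: (le_lt_trans h2); rewrite lte_fin; apply: lt_trans sr.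
      by rewrite distrC ltr_pM2l.
    apply: (le_lt_trans h1); rewrite lte_fin; apply: lt_trans sr.
    by rewrite ltr_pM2l.
  - have HV z : `|phi x' - z| < rho -> chart_ran phi z /\
       k1 <= Num.sqrt (\det (metric g phi z)).
      by move=> /cube_e/eP[rz _ dz]; split=> //; apply: ler_wsqrtr; exact: ltW.
    apply: le_trans (chart_volume_cube ap rho0 (ltW k10) HV).
    rewrite lee_fin.
    have -> : 2 * rho = 2 / (s + s) * r by rewrite /rho; ring.
    rewrite exprMn mulrA; apply: ler_wpM2r; first by rewrite exprn_ge0// ltW.
    exact: ltW.
move=> [[A B] /= [A0 B0] AB].
have [k [k0 Ak]] : exists k, 0 < k /\ A k.
  near (0 : R)^'+ => k; exists k; split.
    by near: k; exact: nbhs_right_gt.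
  by near: k.
exists k => //; apply: filterS B0 => r Br x Lx.
exact: (AB (k, r) (conj Ak Br) x Lx).
Unshelve. all: by end_near. Qed.

End Cubes.

(** * Counting disjoint cells *)

Section Counting.
Context (R : realType) (n : nat) (M : topologicalType).
Context (S : smooth_manifold R n M) (g : riemannian_metric S).
Implicit Types (x y z : M) (L A : set M).

Lemma path_cat x y z l1 l2 : piecewise_C1_length g x y l1 ->
  piecewise_C1_length g y z l2 -> piecewise_C1_length g x z (l1 + l2)%E.
Proof.
move=> H1; elim=> [|c l Hl IH Cc]; first by rewrite adde0.
by rewrite addeA; exact: piecewise_C1_snoc.
Qed.

Lemma dist_triangle_lt x y z (r s : R) : (riemannian_dist g x y < r%:E)%E ->
  (riemannian_dist g y z < s%:E)%E -> (riemannian_dist g x z < (r + s)%:E)%E.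
Proof.
move=> /ereal_inf_lt[l1 H1 l1r] /ereal_inf_lt[l2 H2 l2s].
apply: (@le_lt_trans _ _ (l1 + l2)%E).
  by apply: ereal_inf_lbound; exact: path_cat H2.
by rewrite EFinD; apply: lteD.
Qed.

Lemma vol_ge0 A : (0 <= vol g A)%E.
Proof.
apply: ereal_sup_ubound; exists 0%N.
exists (fun i : 'I_0 => match notF (ltn_ord i) with end).
exists (fun i : 'I_0 => match notF (ltn_ord i) with end).
split; [by case|by case| |by rewrite big_ord0].
by apply/trivIsetP => -[].
Qed.

(** The points are compared in the order in which a greedy choice produces
    them. *)
Definition separated L (r : R) (N : nat) (p : nat -> M) :=
  (forall i, (i < N)%N -> L (p i)) /\
  (forall i j, (i < j)%N -> (j < N)%N ->
     ~ (riemannian_dist g (p i) (p j) < r%:E)%E).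

(** The cells around separated points are disjoint and lie in [A], so they form
    one of the families over which the supremum defining the volume is taken. *)
Lemma separated_vol L A (r kappa : R) N p : 0 < r -> 0 < kappa ->
  (forall x, L x -> small_cell g x kappa r) ->
  (forall x z, L x -> (riemannian_dist g x z < r%:E)%E -> A z) ->
  separated L (r + r) N p -> ((N%:R * (kappa * r ^+ n))%:E <= vol g A)%E.
Proof.
move=> r0 k0 cells LA [pL psep].
have cellp (i : 'I_N) : exists q : chart R n M * set M,
  [/\ atlas S q.1, open q.2, q.2 `<=` chart_dom q.1,
      forall z, q.2 z -> (riemannian_dist g (p i) z < r%:E)%E /\
                       (riemannian_dist g z (p i) < r%:E)%E &
      ((kappa * r ^+ n)%:E <= chart_volume g q.1 q.2)%E].
  have [phi [B HB]] := cells _ (pL i (ltn_ord i)).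
  by exists (phi, B).
have [q Hq] := choice cellp.
apply: (@le_trans _ _ (\sum_(i < N) chart_volume g (q i).1 (q i).2)%E).
  apply: (@le_trans _ _ (\sum_(i < N) (kappa * r ^+ n)%:E)%E).
    by rewrite sumEFin sumr_const card_ord mulr_natl.
  by apply: lee_sum => i _; have [] := Hq i.
apply: ereal_sup_ubound; exists N, (fun i => (q i).1), (fun i => (q i).2).
split => //.
- by move=> i; have [] := Hq i.
- move=> i; have [ai oi di dB _] := Hq i; split.
    exact: sub_sigma_algebra.
  move=> z Bz; split; first exact: di.
  exact: (LA _ _ (pL i (ltn_ord i)) (dB z Bz).1).
- have main (i j : 'I_N) z : (i < j)%N -> (q i).2 z -> (q j).2 z -> False.
    move=> ij Bi Bj; have [_ _ _ di _] := Hq i; have [_ _ _ dj _] := Hq j.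
    apply: (psep i j ij (ltn_ord j)).
    exact: dist_triangle_lt (di z Bi).1 (dj z Bj).2.
  move=> i j _ _ [z [Bi Bj]]; apply/val_inj/eqP; rewrite eqn_leq.
  by apply/andP; split; rewrite leqNgt; apply/negP => ij;
    [exact: (main j i z)|exact: (main i j z)].
Qed.

(** A maximal separated family, chosen greedily, provides both a cover and
    disjoint cells, so the covering number is controlled by the volume. *)
Lemma covering_vol L A (r kappa : R) : 0 < r -> 0 < kappa ->
  (forall x, L x -> small_cell g x kappa r) ->
  (forall x z, L x -> (riemannian_dist g x z < r%:E)%E -> A z) ->
  (covering_number g L (r + r) * (kappa * r ^+ n)%:E <= vol g A)%E.
Proof.
move=> r0 k0 cells LA.
have c0 : 0 < kappa * r ^+ n by rewrite mulr_gt0// exprn_gt0.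
have cov (N : nat) (p : 'I_N -> M) :
    L `<=` \bigcup_i [set y | (riemannian_dist g (p i) y < (r + r)%:E)%E] ->
    (covering_number g L (r + r) <= N%:R%:E)%E.
  by move=> H; apply: ereal_inf_lbound; exists N => //; exists p.
have [[x0 Lx0]|nL] := pselect (exists x, L x); last first.
  apply: le_trans (vol_ge0 _).
  apply: le_trans (_ : (0%:E * (kappa * r ^+ n)%:E <= _)%E); last by rewrite mul0e.
  rewrite lee_pmul2r//.
  apply: (cov 0%N (fun i : 'I_0 => match notF (ltn_ord i) with end)).
  by move=> x Lx; case: nL; exists x.
have [allN|] := pselect (forall N, exists p, separated L (r + r) N p).
  rewrite [leRHS](_ : _ = +oo%E) ?leey//; apply/eqyP => B B0.
  have [N NB] : exists N, B / (kappa * r ^+ n) < N%:R.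
    by exists (Num.truncn (B / (kappa * r ^+ n))).+1; rewrite truncnS_gt.
  have [p Hp] := allN N.
  apply: le_trans (separated_vol r0 k0 cells LA Hp).
  by rewrite lee_fin -ler_pdivrMr// ltW.
move=> /existsNP[N0 HN0].
(* The greedy choice stops at a family that cannot be extended. *)
have [N [p Hp] HN] : exists2 N, exists p, separated L (r + r) N p &
    ~ exists p, separated L (r + r) N.+1 p.
  elim: N0 HN0 => [|N IH] HN; first by case: HN; exists (fun=> x0).
  have [h|h] := pselect (exists p, separated L (r + r) N p); first by exists N.
  exact: IH.
apply: le_trans (separated_vol r0 k0 cells LA Hp).
rewrite [leRHS]EFinM lee_pmul2r//.
apply: (cov N (fun i => p i)) => y Ly; apply: contrapT => ny.
apply: HN; exists (fun i => if (i < N)%N then p i else y); split.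
  by move=> i _; case: ifP => // iN; exact: Hp.1.
move=> i j ij; rewrite ltnS leq_eqVlt => /orP[/eqP jN|jN].
  rewrite -jN ij ltnn => d; apply: ny.
  have iN : (i < N)%N by rewrite -jN.
  by exists (Ordinal iN).
by rewrite jN (ltn_trans ij jN); exact: Hp.2.
Qed.

End Counting.

(** * Orbits that stay close *)

Section Orbits.
Context (R : realType) (n : nat) (M : topologicalType).
Context (S : smooth_manifold R n M) (g : riemannian_metric S).
Context (f : M -> M) (L : set M).
Context (f_C1 : C1_map S f) (L_compact : compact L).
Context (fL : forall x, L x -> L (f x)).

Lemma norm_bounded F : C1_map S F ->
  exists2 B, 1 <= B & forall x, L x -> tangent_map_norm g F x < B.
Proof.
move=> CF; move/compact_near_coveringP : L_compact.
move=> /(_ _ (+oo : set_system R) (fun B x => tangent_map_norm g F x < B) _).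
case.
  move=> x Lx; pose A := tangent_map_norm g F x + 1.
  have n1 : \forall y \near x, opbound g F y A by apply: opbound_near; rewrite ?ltrDl.
  have n2 : \forall B \near +oo, A < B by apply: nbhs_pinfty_gt; exact: num_real.
  exists ([set y | opbound g F y A], [set B | A < B]) => // -[y B] /= [yA AB].
  apply: le_lt_trans AB; apply: norm_opbound => //.
  by rewrite addr_ge0// tangent_map_norm_ge0.
move=> B [Br HB]; exists (Num.max (B + 1) 1); first by rewrite le_max lexx orbT.
by apply: HB; rewrite lt_max ltrDl ltr01.
Qed.

Lemma L_iter k x : L x -> L (iter k f x).
Proof. by move=> Lx; elim: k => //= k; exact: fL. Qed.

(** A crude constant suffices for the fewer than [q] steps left over after
    grouping the iterates in blocks of length [q]. *)
Lemma dist_iter_lt q : exists B delta, [/\ 1 <= B, 0 < delta &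
  forall j x y r, (j < q)%N -> L x -> r <= delta ->
    (riemannian_dist g x y < r%:E)%E ->
    (riemannian_dist g (iter j f x) (iter j f y) < (B * r)%:E)%E].
Proof.
have [B1 B11 HB1] := norm_bounded f_C1.
have B10 : 0 < B1 by exact: lt_le_trans B11.
have [d1 d10 Hd1] := dist_expansion L_compact f_C1 B10 HB1.
have rpos x y (r : R) : (riemannian_dist g x y < r%:E)%E -> 0 < r.
  move=> /ereal_inf_lt[l Hl lr]; rewrite -lte_fin; apply: le_lt_trans lr.
  exact: path_length_ge0 Hl.
elim: q => [|q [B [d [B0 d0 H]]]]; first by exists 1, 1.
have Bp : 0 < B by exact: lt_le_trans B0.
exists (B1 * B), (Num.min d (d1 / B)); split.
- by rewrite -[1]mulr1; apply: ler_pM.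
- by rewrite lt_min d0 divr_gt0.
move=> j x y r; rewrite ltnS => jq Lx; rewrite le_min => /andP[rd rd1] xy.
have r0 := rpos _ _ _ xy.
case: j jq => [|j] jq.
  apply: (lt_le_trans xy); rewrite lee_fin ler_peMl ?(ltW r0)//.
  by rewrite -[1]mulr1; apply: ler_pM.
rewrite /= -mulrA; apply: Hd1; first exact: L_iter.
  by rewrite mulrC -ler_pdivlMr.
exact: H.
Qed.

(** One block of [q] iterates expands distances by less than exp (q s).  The
    induction over the blocks works because at the end of every block before time
    [m] the bound on the distance is still at most [kappa], so the expansion
    estimate applies again. *)
Lemma orbits_stay_close (V : set M) (q : nat) (s : R) :
  open V -> L `<=` V -> (0 < q)%N -> 0 <= s ->
  (forall x, L x -> tangent_map_norm g (iter q f) x < expR (q%:R * s)) ->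
  exists2 kappa, 0 < kappa & forall (m : nat) (r : R) x z,
    r <= kappa * expR (- (m%:R * s)) -> L x ->
    (riemannian_dist g x z < r%:E)%E ->
    (\bigcap_(k in [set k | (k < m)%N]) (iter k f @^-1` V)) z.
Proof.
move=> oV LV q0 s0 Hq.
have [dV dV0 HV] := dist_nbhd g L_compact oV LV.
have [B [dB [B1 dB0 HB]]] := dist_iter_lt q.
have Bp : 0 < B by exact: lt_le_trans B1.
pose A := expR (q%:R * s); have A0 : 0 < A by exact: expR_gt0.
have A1 : 1 <= A by rewrite -expR0 ler_expR mulr_ge0.
have [dA dA0 HA] := dist_expansion L_compact (C1_map_iter q f_C1) A0 Hq.
pose kappa := Num.min dA (Num.min dB (dV / B)).
have kappa0 : 0 < kappa by rewrite !lt_min dA0 dB0 divr_gt0.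
have [kA kB kV] : [/\ kappa <= dA, kappa <= dB & B * kappa <= dV].
  by split; rewrite 1?mulrC -?ler_pdivlMr// !ge_min lexx ?orbT.
exists kappa => // m r x z rm Lx xz k /= km.
have blocks i : A ^+ i * r <= kappa ->
    (riemannian_dist g (iter (i * q) f x) (iter (i * q) f z) < (A ^+ i * r)%:E)%E.
  elim: i => [|i IH] ir; first by rewrite mul0n expr0 mul1r.
  have r0 : 0 < r.
    move: xz => /ereal_inf_lt[l Hl lr]; rewrite -lte_fin; apply: le_lt_trans lr.
    exact: path_length_ge0 Hl.
  have ir' : A ^+ i * r <= kappa.
    apply: le_trans ir; rewrite ler_pM2r// exprS ler_peMl// exprn_ge0//.
    exact: ltW.
  rewrite mulSn !iterD exprS -mulrA; apply: HA; first exact: L_iter.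
    exact: le_trans kA.
  exact: IH.
have kE := divn_eq k q; set i := (k %/ q)%N in kE.
have iqm : (i * q <= m)%N.
  by apply: leq_trans (ltnW km); rewrite [leqRHS]kE leq_addr.
have ir : A ^+ i * r <= kappa.
  apply: (@le_trans _ _ (A ^+ i * (kappa * expR (- (m%:R * s))))).
    by rewrite ler_pM2l// exprn_gt0.
  rewrite mulrCA ler_piMr ?(ltW kappa0)// /A -expRM_natl -expRD.
  rewrite -[leRHS]expR0 ler_expR mulrA -natrM -mulrBl.
  by rewrite mulr_le0_ge0// subr_le0 ler_nat.
rewrite kE addnC iterD; apply: HV (_ : L (iter (k %% q) f (iter (i * q) f x))) _.
  by do 2 apply: L_iter.
apply: (@lt_le_trans _ _ (B * (A ^+ i * r))%:E).
  apply: HB; [by rewrite ltn_mod|exact: L_iter|exact: le_trans kB|exact: blocks].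
by rewrite lee_fin; apply: le_trans kV; rewrite ler_pM2l.
Qed.

End Orbits.

(** * Limits superior and logarithms in the extended reals *)

Section LimitsSuperior.
Context (R : realType).

Lemma limn_esup_gt (u : nat -> \bar R) (e : \bar R) : (e < limn_esup u)%E ->
  forall N, exists2 m, (N <= m)%N & (e < u m)%E.
Proof.
move=> eu N.
have : (e < ereal_sup (u @` [set m | (N <= m)%N]))%E.
  apply: (lt_le_trans eu); apply: ereal_inf_lbound.
  by exists [set m | (N <= m)%N] => //; exact: nbhs_infty_ge.
by move=> /ereal_sup_gt[_ [m Nm <-] em]; exists m.
Qed.

Lemma le_limf_esup (T : choiceType) (X : filteredType T) (u : X -> \bar R)
    (F : set_system X) (y : \bar R) :
  (\forall x \near F, (u x <= y)%E) -> (limf_esup u F <= y)%E.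
Proof.
move=> Fu; apply: (@le_trans _ _ (ereal_sup (u @` [set x | (u x <= y)%E]))).
  by apply: ereal_inf_lbound; exists [set x | (u x <= y)%E].
by apply: ge_ereal_sup => _ [x ux <-].
Qed.

Lemma limn_esup_lt (u : nat -> \bar R) (y : \bar R) : (limn_esup u < y)%E ->
  exists N, forall m, (N <= m)%N -> (u m < y)%E.
Proof.
move=> /ereal_inf_lt[_ [A [N _ NA] <-] Ay]; exists N => m Nm.
apply: le_lt_trans Ay; apply: ereal_sup_ubound; exists m => //.
exact: NA.
Qed.

Lemma lne_le (x : \bar R) (y : R) : (0 <= x)%E -> (lne x <= y%:E)%E ->
  (x <= (expR y)%:E)%E.
Proof.
case: x => [r|_|//].
  rewrite lee_fin le_eqVlt => /orP[/eqP <- _|r0].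
    by rewrite lee_fin expR_ge0.
  by rewrite lne_EFin// !lee_fin -ler_expR lnK.
by rewrite /= leye_eq.
Qed.

Lemma le_lne (x : \bar R) (y : R) : (x <= (expR y)%:E)%E -> (lne x <= y%:E)%E.
Proof.
case: x => [r| |] //.
  rewrite lee_fin => ry; have [r0|r0] := leP r 0; first by rewrite le0_lneNy// leNye.
  by rewrite lne_EFin// lee_fin -(expRK y) ler_ln ?posrE ?expR_gt0.
by move=> _; rewrite le0_lneNy// leNye.
Qed.

End LimitsSuperior.

(** * Growth of the norm of the differential *)

Section Fekete.
Context (R : realType) (a : nat -> R).
Context (subadd : forall m k, a (m + k)%N <= a m + a k).

(** Grouping a time [m] in blocks of length [q] leaves a remainder with finitely
    many values, which is where the constant comes from. *)
Lemma subadditive_le q : (0 < q)%N ->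
  exists C, forall m, a m <= m%:R * (a q / q%:R) + C.
Proof.
move=> q0; have q0' : q%:R != 0 :> R by rewrite pnatr_eq0 -lt0n.
pose b j := a j - j%:R * (a q / q%:R).
exists (\sum_(j < q) `|b j|) => m.
have blocks i j : a (i * q + j)%N <= i%:R * a q + a j.
  elim: i => [|i IH]; first by rewrite mul0r add0r.
  rewrite mulSn -addnA; apply: (le_trans (subadd _ _)).
  by rewrite -[i.+1%:R]natr1 mulrDl mul1r addrAC [leRHS]addrC lerD2l.
rewrite {1}(divn_eq m q); apply: (le_trans (blocks _ _)).
have jq : (m %% q < q)%N by rewrite ltn_mod.
apply: (@le_trans _ _ (m%:R * (a q / q%:R) + b (m %% q)%N)); last first.
  rewrite lerD2l; apply: (le_trans (ler_norm _)).
  rewrite (bigD1 (Ordinal jq))//= lerDl.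
  by apply: sumr_ge0 => *; exact: normr_ge0.
have e : m%:R = (m %/ q)%:R * q%:R + (m %% q)%:R :> R.
  by rewrite -natrM -natrD -divn_eq.
rewrite /b e.
by rewrite le_eqVlt; apply/orP; left; apply/eqP; field.
Qed.

(** Fekete's lemma, in the form in which linear growth along some sequence of
    times replaces the lower bound. *)
Lemma fekete_gt0 (eps C : R) : 0 < eps ->
  (forall N, exists2 m, (N <= m)%N & eps * m%:R <= a m + C) ->
  exists2 s : R, 0 < s & m%:R^-1 * a m @[m --> \oo] --> s.
Proof.
move=> eps0 grow.
have lower q : (0 < q)%N -> eps <= a q / q%:R.
  move=> q0; rewrite leNgt; apply/negP => qeps.
  have [D HD] := subadditive_le q0.
  have d0 : 0 < eps - a q / q%:R by rewrite subr_gt0.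
  have [m mN] := grow (Num.truncn ((D + C) / (eps - a q / q%:R))).+1.
  move=> mgrow; have : (eps - a q / q%:R) * m%:R <= D + C.
    have := le_trans mgrow (lerD (HD m) (lexx C)); rewrite mulrBl; lra.
  rewrite mulrC -ler_pdivlMr// leNgt => /negP; apply.
  by apply: (lt_le_trans (truncnS_gt _)); rewrite ler_nat.
pose B := [set a q / q%:R | q in [set q | (0 < q)%N]].
have hB : has_inf B.
  split; first by exists (a 1%N / 1%:R), 1%N.
  by exists eps => _ [q /= q0 <-]; exact: lower.
exists (inf B).
  apply: (lt_le_trans eps0); apply: lb_le_inf; first exact: hB.1.
  by move=> _ [q /= q0 <-]; exact: lower.
apply/cvgrPdist_lt => e e0.
have e20 : 0 < e / 2 by rewrite divr_gt0.
have [_ [q /= q0 <-] qe] := inf_adherent e20 hB.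
have [D HD] := subadditive_le q0.
near=> m.
have m0 : (0 < m)%N by near: m; exact: nbhs_infty_gt.
have m0' : 0 < m%:R :> R by rewrite ltr0n.
have l1 : inf B <= a m / m%:R by apply: ge_inf; [exact: hB.2|exists m].
have l2 : a m / m%:R <= a q / q%:R + D / m%:R.
  rewrite ler_pdivrMr// mulrDl divfK ?gt_eqF// [a q / _ * _]mulrC.
  exact: HD.
have l3 : D / m%:R < e / 2.
  rewrite ltr_pdivrMr// mulrC -ltr_pdivrMr//.
  apply: lt_le_trans (truncnS_gt _) _; rewrite ler_nat.
  by near: m; exact: nbhs_infty_ge.
rewrite distrC mulrC ger0_norm ?subr_ge0//.
rewrite ltrBlDl; apply: (le_lt_trans l2).
by rewrite (splitr e) addrA; apply: ltrD.
Unshelve. all: by end_near. Qed.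

End Fekete.

Section Growth.
Context (R : realType) (n : nat) (M : topologicalType).
Context (S : smooth_manifold R n M) (g : riemannian_metric S).
Context (f : M -> M) (L : set M).
Context (f_C1 : C1_map S f) (L_compact : compact L).
Context (fL : forall x, L x -> L (f x)).

Definition max_norm (m : nat) : R :=
  sup [set tangent_map_norm g (iter m f) x | x in L].

Lemma max_norm_ub m x : L x -> tangent_map_norm g (iter m f) x <= max_norm m.
Proof.
move=> Lx; have [B _ HB] := norm_bounded g L_compact (C1_map_iter m f_C1).
apply: sup_upper_bound; last by exists x.
split; first by exists (tangent_map_norm g (iter m f) x), x.
by exists B => _ [y Ly <-]; exact/ltW/HB.
Qed.

Lemma opbound_max_norm m x : L x -> opbound g (iter m f) x (max_norm m).
Proof.
move=> Lx; apply: opbound_le (max_norm_ub m Lx) _.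
by apply: opbound_norm; exact: C1_map_iter.
Qed.

Lemma max_norm_ge0 m x : L x -> 0 <= max_norm m.
Proof.
move=> Lx; apply: le_trans (max_norm_ub m Lx).
by apply: tangent_map_norm_ge0; exact: C1_map_iter.
Qed.

Lemma max_normM m k x : L x -> max_norm (m + k) <= max_norm m * max_norm k.
Proof.
move=> Lx; apply: ge_sup; first by exists (tangent_map_norm g (iter (m + k) f) x), x.
move=> _ [y Ly <-]; apply: norm_opbound.
- exact: C1_map_iter.
- by rewrite mulr_ge0// (max_norm_ge0 _ Ly).
- have -> : iter (m + k) f = iter m f \o iter k f.
    by apply/funext => z; exact: iterD.
  apply: opbound_comp; try exact: C1_map_iter.
  + exact: max_norm_ge0 Ly.
  + by apply: opbound_max_norm; exact: L_iter.
  + exact: opbound_max_norm.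
Qed.

(** The norms along the vector with a positive exponent exceed exp (e m) for
    infinitely many [m].  They are bounded by the maximal norms, which forces the
    latter to be positive and to grow linearly on the logarithmic scale. *)
Lemma expansion_rate_gt0 :
  (exists x v, [/\ L x, v != 0 & (0 < upper_lyapunov g f x v)%E]) ->
  0 < expansion_rate g f L /\
  (m%:R^-1 * ln (max_norm m) : R) @[m --> \oo] --> expansion_rate g f L.
Proof.
move=> [x [v [Lx v0 lyap]]].
have [e e0 eP] : exists2 e : R, 0 < e & (e%:E < upper_lyapunov g f x v)%E.
  move: lyap; case: (upper_lyapunov g f x v) => [r| |] // r0.
    exists (r / 2); first by rewrite divr_gt0.
    by rewrite lte_fin ltr_pdivrMr// ltr_pMr// ltr1n.
  by exists 1 => //; exact: ltry.
have often := limn_esup_gt eP.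
pose w m := tangent_norm g (iter m f x) (tangent_map S (iter m f) x v).
have wP N : exists m, [/\ (N <= m)%N, 0 < w m & e * m%:R <= ln (w m)].
  have [m Nm] := often (maxn N 1); rewrite lte_fin -/(w m) => em.
  move: Nm; rewrite geq_max => /andP[Nm m0].
  have m0' : 0 < m%:R :> R by rewrite ltr0n.
  have lnw : e * m%:R < ln (w m) by rewrite mulrC -ltr_pdivlMl.
  exists m; split => //; last exact: ltW.
  rewrite ltNge; apply/negP => w0.
  by move: lnw; rewrite ln0// ltNge mulr_ge0// ltW.
have wle m : w m <= max_norm m * tangent_norm g x v by exact: opbound_max_norm.
have tv : 0 < tangent_norm g x v by exact: tangent_norm_gt0.
(* A vanishing norm at time [m] would persist at all later times. *)
have Apos m : 0 < max_norm m.
  rewrite lt_neqAle (max_norm_ge0 _ Lx) andbT eq_sym; apply/eqP => A0.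
  have [k [mk wk _]] := wP m.
  have Ak : max_norm k <= 0.
    by have := max_normM m (k - m) Lx; rewrite subnKC// A0 mul0r.
  have : w k <= 0 by apply: (le_trans (wle k)); rewrite mulr_le0_ge0// ltW.
  by rewrite leNgt wk.
have sub m k : ln (max_norm (m + k)) <= ln (max_norm m) + ln (max_norm k).
  rewrite -lnM ?posrE//; rewrite ler_ln ?posrE ?mulr_gt0//.
  exact: max_normM Lx.
have [N|s s0 cs] := @fekete_gt0 R (fun m => ln (max_norm m)) sub e
  (ln (tangent_norm g x v)) e0.
  have [m [Nm wm em]] := wP N; exists m => //.
  apply: (le_trans em); rewrite -lnM ?posrE//.
  by rewrite ler_ln ?posrE ?mulr_gt0.
have es : expansion_rate g f L = s by exact: cvg_lim cs.
by rewrite es.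
Qed.

End Growth.

(** * From counting to dimension *)

Section Dimension.
Context (R : realType) (n : nat) (M : topologicalType).
Context (S : smooth_manifold R n M) (g : riemannian_metric S).
Context (f : M -> M) (L V : set M).
Context (f_C1 : C1_map S f) (L_compact : compact L).
Context (fL : forall x, L x -> L (f x)).
Context (V_open : open V) (LV : L `<=` V).

(** For a radius [r] the number [m] of steps is the largest integer with
    [r <= k1 * expR (- m s)]; then [m s] differs from
    [- ln r] by a bounded amount, so replacing one by the other in the logarithm
    of the volume bound costs only a constant. *)
Lemma upper_box_dim_le (q : nat) (s E : R) : (0 < q)%N -> 0 < s ->
  (forall x, L x -> tangent_map_norm g (iter q f) x < expR (q%:R * s)) ->
  (upper_escape_rate g f V < E%:E)%E ->
  (upper_box_dim g L <= (n%:R + E / s)%:E)%E.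
Proof.
move=> q0 s0 Hq /limn_esup_lt[N HN].
have [k1 k10 close] := orbits_stay_close f_C1 L_compact fL V_open LV q0 (ltW s0) Hq.
have [k2 k20 cells] := small_cells g L_compact.
set Vm := fun m : nat => \bigcap_(k in [set k | (k < m)%N]) (iter k f @^-1` V).
have volle m : (maxn N 1 <= m)%N -> (vol g (Vm m) <= (expR (m%:R * E))%:E)%E.
  rewrite geq_max => /andP[Nm m1]; have m0 : 0 < m%:R :> R by rewrite ltr0n.
  apply: lne_le; first exact: vol_ge0.
  have := ltW (HN m Nm); rewrite -/(Vm m).
  by rewrite muleC lee_pdivrMr// -EFinM mulrC.
(* [C] absorbs the bounded errors of the choice of [m] and of the constants. *)
pose C := `|ln k1 + ln 2| * `|E / s| + `|E| + `|ln k2| + n%:R * `|ln 2|.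
have main : \forall e \near (0 : R)^'+,
    (lne (covering_number g L e) <= (- ln e * (n%:R + E / s) + C)%:E)%E.
  have ncells : \forall e \near (0 : R)^'+,
      forall x, L x -> small_cell g x k2 (e / 2).
    have [d /= d0 dP] := cells.
    near=> e; have e0 : 0 < e by near: e; exact: nbhs_right_gt.
    have ed : e < d by near: e; exact: nbhs_right_lt.
    apply: dP; rewrite /= ?divr_gt0// sub0r normrN gtr0_norm ?divr_gt0//.
    by apply: lt_trans ed; rewrite ltr_pdivrMr// ltr_pMr// ltr1n.
  near=> e.
  have e0 : 0 < e by near: e; exact: nbhs_right_gt.
  have cellr : forall x, L x -> small_cell g x k2 (e / 2) by near: e.
  pose r := e / 2; have r0 : 0 < r by rewrite divr_gt0.
  pose T := ln k1 - ln r.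
  have Tbig : (maxn N 1).+1%:R * s <= T.
    rewrite /T lerBrDl -lerBrDr -ler_expR lnK ?posrE//.
    rewrite /r ler_pdivrMr//; apply/ltW.
    by near: e; apply: nbhs_right_lt; rewrite mulr_gt0// expR_gt0.
  have T0 : 0 <= T / s.
    by rewrite divr_ge0 ?(ltW s0)//; apply: le_trans Tbig; rewrite mulr_ge0// ltW.
  pose m := Num.truncn (T / s).
  have [mT Tm] : m%:R * s <= T /\ T < (m%:R + 1) * s.
    have := truncn_itv T0; rewrite -/m => /andP[h1 h2].
    by rewrite -ler_pdivlMr// -ltr_pdivrMr// natr1.
  have Nm : (maxn N 1 <= m)%N.
    have := le_lt_trans Tbig Tm; rewrite ltr_pM2r// natr1 ltr_nat.
    by rewrite ltnS => /ltnW.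
  have rm : r <= k1 * expR (- (m%:R * s)).
    rewrite -ler_pdivrMl// -ler_ln ?posrE ?expR_gt0//; last by rewrite mulr_gt0 ?invr_gt0.
    rewrite expRK lnM ?posrE ?invr_gt0// lnV ?posrE//.
    move: mT; rewrite /T; lra.
  have := @covering_vol _ _ _ _ g L (Vm m) r k2 r0 k20.
  have -> : r + r = e by rewrite /r -splitr.
  move=> /(_ _ _)/le_trans/(_ (volle m Nm)) cov.
  have {}cov : (covering_number g L e * (k2 * r ^+ n)%:E <= (expR (m%:R * E))%:E)%E.
    apply: cov; first exact: cellr.
    by move=> x z Lx xz; exact: (close m r x z rm Lx xz).
  have c0 : 0 < k2 * r ^+ n by rewrite mulr_gt0// exprn_gt0.
  apply: (@le_trans _ _ (m%:R * E - ln k2 - n%:R * ln r)%:E).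
    apply: le_lne.
    have -> : expR (m%:R * E - ln k2 - n%:R * ln r) =
              expR (m%:R * E) * (k2 * r ^+ n)^-1.
      by rewrite !expRD !expRN [expR (n%:R * _)]expRM_natl !lnK ?posrE// invfM mulrA.
    by rewrite EFinM lee_pdivlMr.
  rewrite lee_fin.
  have lr : ln r = ln e - ln 2 by rewrite /r lnM ?posrE ?invr_gt0// lnV ?posrE.
  have mE : m%:R * E <= T * (E / s) + `|E|.
    rewrite (_ : m%:R * E = T * (E / s) - (T - m%:R * s) * (E / s)); last first.
      by field; rewrite gt_eqF.
    rewrite lerD2l; apply: (le_trans (ler_norm _)).
    rewrite normrN !normrM normfV (gtr0_norm s0) (ger0_norm (_ : 0 <= T - _)) ?subr_ge0//.
    rewrite mulrA ler_pdivrMr// mulrC ler_wpM2l//.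
    move: Tm; rewrite mulrDl mul1r => Tm; rewrite lerBlDl; exact: ltW.
  have TE : T * (E / s) <= - ln e * (E / s) + `|ln k1 + ln 2| * `|E / s|.
    rewrite (_ : T = - ln e + (ln k1 + ln 2)); last by rewrite /T lr; ring.
    by rewrite mulrDl lerD2l (le_trans (ler_norm _))// normrM.
  have k2n : - ln k2 <= `|ln k2| by rewrite -normrN ler_norm.
  have n2 : n%:R * ln 2 <= n%:R * `|ln 2| :> R by rewrite ler_wpM2l// ler_norm.
  rewrite lr /C !mulrDr mulrN; lra.
apply/lee_addgt0Pr => eta eta0; apply: le_limf_esup.
have nC : \forall e \near (0 : R)^'+, e < 1 /\ C <= - ln e * eta.
  have : \forall e \near (0 : R)^'+, e < Num.min 1 (expR (- (C / eta))).
    by apply: nbhs_right_lt; rewrite lt_min ltr01 expR_gt0.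
  have : \forall e \near (0 : R)^'+, 0 < e by exact: nbhs_right_gt.
  apply: filterS2 => e e0; rewrite lt_min => /andP[-> ee]; split => //.
  rewrite -ler_pdivrMr// lerNr -[leRHS]expRK ler_ln ?posrE ?expR_gt0//.
  exact: ltW.
near=> e.
have e0 : 0 < e by near: e; exact: nbhs_right_gt.
have [e1 Ce] : e < 1 /\ C <= - ln e * eta by near: e.
have le0 : 0 < - ln e by rewrite oppr_gt0 -ln1 ltr_ln ?posrE.
rewrite inver gt_eqF// lee_pdivrMr// -EFinD -EFinM.
apply: le_trans (_ : ((- ln e * (n%:R + E / s) + C)%:E <= _)%E).
  by near: e.
by rewrite lee_fin [leRHS]mulrC [leRHS]mulrDr lerD2l.
Unshelve. all: by end_near. Qed.

End Dimension.

Theorem theorem4 (R : realType) (n : nat) (M : topologicalType)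
    (S : smooth_manifold R n M) (g : riemannian_metric S)
    (f : M -> M) (f_diffeo : Ck_diffeo S 2 f)
    (L : set M) (L_compact : compact L) (L_invariant : f @` L = L)
    (L_locmax : locally_maximal f L)
    (L_entropy : (0 < top_entropy g f L)%E)
    (L_lyapunov : exists x v,
       [/\ L x, v != 0 & (0 < upper_lyapunov g f x v)%E])
    (U : set M) (U_isolating : isolating_nbhd f L U)
    (V : set M) (V_open : open V) (L_sub_V : L `<=` V) (V_sub_U : V `<=` U) :
  (upper_box_dim g L <=
     n%:R%:E + upper_escape_rate g f V / (expansion_rate g f L)%:E)%E /\
  ((upper_escape_rate g f V < 0)%E -> (upper_box_dim g L < n%:R%:E)%E).
Proof.
have f_C1 : C1_map S f by have [h [_ _ Cf _]] := f_diffeo; exact: Ck_map_C1 Cf.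
have fL x : L x -> L (f x) by move=> Lx; rewrite -L_invariant; exists x.
have [s0 cs] := expansion_rate_gt0 f_C1 L_compact fL L_lyapunov.
set s := expansion_rate g f L in s0 cs *.
set E := upper_escape_rate g f V.
have near_rates (s' E' : R) : s < s' -> (E < E'%:E)%E ->
    (upper_box_dim g L <= (n%:R + E' / s')%:E)%E.
  move=> ss' EE'; have s'0 : 0 < s' by exact: lt_trans ss'.
  (* One power of [f] whose norm on [L] already reflects the rate [s']. *)
  have [q [q0 qs]] : exists q, (0 < q)%N /\ q%:R^-1 * ln (max_norm g f L q) < s'.
    near \oo => q; exists q; split; near: q; first exact: nbhs_infty_gt.
    exact: (cvgr_lt _ cs).
  apply: (upper_box_dim_le f_C1 L_compact fL V_open L_sub_V q0 s'0 _ EE').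
  move=> x Lx; apply: (le_lt_trans (max_norm_ub g f_C1 L_compact q Lx)).
  have [A0|A0] := leP (max_norm g f L q) 0.
    by apply: (le_lt_trans A0); exact: expR_gt0.
  by rewrite -[ltLHS]lnK// ltr_expR -ltr_pdivrMl ?ltr0n.
have near_escape (E' : R) : (E < E'%:E)%E ->
    (upper_box_dim g L <= (n%:R + E' / s)%:E)%E.
  move=> EE'; apply/lee_addgt0Pr => eta eta0.
  have [s' [ss' s'E]] : exists s', s < s' /\ E' / s' < E' / s + eta.
    have cv : E' / s' @[s' --> s^'+] --> E' / s.
      apply: cvg_at_right_filter; apply: cvgM; first exact: cvg_cst.
      by apply: cvgV; [rewrite gt_eqF|exact: cvg_id].
    near s^'+ => s'; exists s'; split; near: s'; first exact: nbhs_right_gt.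
    by apply: (cvgr_lt _ cv); rewrite ltrDl.
  apply: (le_trans (near_rates s' E' ss' EE')).
  by rewrite -EFinD lee_fin -addrA lerD2l ltW.
have dim_le : (upper_box_dim g L <= n%:R%:E + E / s%:E)%E.
  rewrite inver gt_eqF//; move: near_escape; case: (E) => [e| |] near_escape.
  - rewrite -EFinM -EFinD; apply/lee_addgt0Pr => eta eta0.
    apply: (le_trans (near_escape (e + eta * s) _)).
      by rewrite lte_fin ltrDl mulr_gt0.
    rewrite -EFinD lee_fin -addrA lerD2l mulrDl mulfK// gt_eqF//.
  - by rewrite gt0_mulye ?lte_fin ?invr_gt0// addey// leey.
  - rewrite gt0_mulNye ?lte_fin ?invr_gt0// addeNy.
    move: near_escape; case: (upper_box_dim g L) => [d| |//] /= dE.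
      have := dE ((d - 1 - n%:R) * s) (ltNyr _).
      by rewrite mulfK ?gt_eqF// lee_fin addrC subrK leNgt ltrBlDr ltrDl ltr01.
    by have := dE 0 (ltNyr _); rewrite leye_eq.
split => // E0; apply: (le_lt_trans dim_le).
rewrite inver gt_eqF//; move: E0; case: (E) => [e| |] //.
  rewrite lte_fin => e0; rewrite -EFinM -EFinD lte_fin -[ltRHS]addr0 ltrD2l.
  by rewrite nmulr_rlt0 ?invr_gt0.
by move=> _; rewrite gt0_mulNye ?lte_fin ?invr_gt0// addeNy ltNyr.
Unshelve. all: by end_near. Qed.
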